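(* Let $G$ be a closed graph on the vertex set $[n]$ (with its vertices labelled so that $G$ is closed with respect to this labelling). Then for all $i\ge 0$, $$\beta_{i,i+2}(J_G)\leq \beta_{i,i+2}(\mathrm{in}_{<}J_G)=\beta_{i,i+2}(I(\mathrm{in}_{<}(G)))=(i+1)k_{i+2}(G).$$
   Context: Let $K$ be a field. For a finite simple graph $G$ with vertex set $[n]$ and edge set $E(G)$, let $S=K[x_1,\ldots,x_n,y_1,\ldots,y_n]$ (standard grading); the binomial edge ideal $J_G\subset S$ is generated by the binomials $f_{ij}=x_iy_j-x_jy_i$ with $i<j$ and $\{i,j\}\in E(G)$. Let $<$ be the lexicographic order on $S$ induced by $x_1>\cdots>x_n>y_1>\cdots>y_n$, and let $\mathrm{in}_<J_G$ be the initial ideal of $J_G$. The graph $G$ is closed (with respect to the given labelling) if $J_G$ has a quadratic Gröbner basis with respect to $<$, equivalently if the generators $f_{ij}$ form a Gröbner basis. For such a $G$, $\mathrm{in}_<(G)$ denotes the bipartite graph on the vertex set $\{x_1,\dots,x_n\}\cup\{y_1,\dots,y_n\}$ whose edges are the pairs $\{x_i,y_j\}$ with $i<j$ and $\{i,j\}\in E(G)$. $I(H)$ denotes the monomial edge ideal of a graph $H$, generated by the products of the two endpoints (variables) of each edge of $H$; here $I(\mathrm{in}_<(G))\subset S$. $\beta_{i,j}$ denotes graded Betti numbers over $S$. For $i\ge1$, $k_i(G)$ is the number of cliques of $G$ (not necessarily maximal) isomorphic to the complete graph $K_i$. *)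

(* Defs.v *)
From HB Require Import structures.
From mathcomp Require Import all_boot all_order all_algebra.
From mathcomp Require Import mpoly.
From Stdlib Require Import ClassicalEpsilon.

Set Implicit Arguments.
Unset Strict Implicit.
Unset Printing Implicit Defensive.

Import GRing.Theory.
Local Open Scope ring_scope.

(* Subsets of a polynomial ring, in particular ideals, are Prop-valued
   predicates. *)

Definition ideal_gen (m : nat) (K : fieldType) (P : {mpoly K[m]} -> Prop)
    (f : {mpoly K[m]}) : Prop :=
  exists (k : nat) (c g : 'I_k -> {mpoly K[m]}),
    (forall i, P (g i)) /\ f = \sum_(i < k) c i * g i.

(* Pure lexicographic order, the variable of index 0 being the largest one;
   mpoly's own order on monomials (used by mlead) is degree-first. *)
Definition lex_lt (m : nat) (u v : 'X_{1..m}) : bool :=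
  [exists k : 'I_m, [forall l : 'I_m, (l < k)%N ==> (u l == v l)]
                    && (u k < v k)%N].

Definition is_lead_monom (m : nat) (K : fieldType) (f : {mpoly K[m]})
    (u : 'X_{1..m}) : Prop :=
  u \in msupp f /\ forall v, v \in msupp f -> v != u -> lex_lt v u.

(* The ideal generated by the leading monomials of the nonzero elements
   of P; P is not required to be an ideal. *)
Definition initial_ideal (m : nat) (K : fieldType) (P : {mpoly K[m]} -> Prop) :
    {mpoly K[m]} -> Prop :=
  ideal_gen (fun q => exists f u, [/\ P f, is_lead_monom f u & q = 'X_[u]]).

Definition is_groebner_basis (m : nat) (K : fieldType)
    (I : {mpoly K[m]} -> Prop) (gs : seq {mpoly K[m]}) : Prop :=
  (forall g, g \in gs -> I g) /\
  (forall f, initial_ideal I f <-> initial_ideal (fun g => g \in gs) f).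

(* A minimal graded free resolution
     ... -> F_2 -> F_1 -> F_0 -> I -> 0,
   F_i = \bigoplus_(a < mgr_rank i) S(- mgr_deg i a).
   Elements of F_i are row vectors, on which mgr_diff i : F_{i+1} -> F_i acts
   by right multiplication; mgr_gen lists the images in I of the basis of F_0.
   The inequality in mgr_diff_lt is needed because subtraction on nat is
   truncated. *)
Record min_graded_resolution (m : nat) (K : fieldType)
    (I : {mpoly K[m]} -> Prop) := MinGradedResolution {
  mgr_rank : nat -> nat;
  mgr_deg : forall i, 'I_(mgr_rank i) -> nat;
  mgr_gen : 'cV[{mpoly K[m]}]_(mgr_rank 0);
  mgr_diff : forall i, 'M[{mpoly K[m]}]_(mgr_rank i.+1, mgr_rank i);
  mgr_gen_homog : forall a, mgr_gen a 0 \is (mgr_deg a).-homog;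
  mgr_diff_homog : forall i a b,
    mgr_diff i a b \is (mgr_deg a - mgr_deg b)%N.-homog;
  mgr_diff_lt : forall i (a : 'I_(mgr_rank i.+1)) (b : 'I_(mgr_rank i)),
    (mgr_deg a < mgr_deg b)%N -> mgr_diff i a b = 0;
  mgr_surj : forall f,
    I f <-> exists v : 'rV_(mgr_rank 0), f = (v *m mgr_gen) 0 0;
  mgr_exact0 : forall v : 'rV_(mgr_rank 0),
    v *m mgr_gen = 0 <-> exists w, v = w *m mgr_diff 0;
  mgr_exactS : forall i (v : 'rV_(mgr_rank i.+1)),
    v *m mgr_diff i = 0 <-> exists w, v = w *m mgr_diff i.+1;
  mgr_minimal : forall i a b, (mgr_diff i a b)@_(0%MM) = 0
}.

Definition resolution_betti (m : nat) (K : fieldType)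
    (I : {mpoly K[m]} -> Prop) (F : min_graded_resolution I) (i j : nat) : nat :=
  #|[set a : 'I_(mgr_rank F i) | mgr_deg a == j]|.

(* beta_{i,j}(I), I being resolved as a module (not m |-> S / I).  Every
   homogeneous ideal has a minimal graded free resolution, and it is unique up
   to isomorphism, so the choice below is immaterial for such an I. *)
Definition graded_betti (m : nat) (K : fieldType)
    (I : {mpoly K[m]} -> Prop) (i j : nat) : nat :=
  epsilon (inhabits 0%N)
    (fun b => exists F : min_graded_resolution I, resolution_betti F i j = b).

(* {mpoly K[n + n]} is K[x_1, ..., x_n, y_1, ..., y_n]: the index lshift n i
   stands for x_i and rshift n i for y_i. *)

Definition edge_binomial (K : fieldType) (n : nat) (i j : 'I_n) :
    {mpoly K[n + n]} :=
  'X_(lshift n i) * 'X_(rshift n j) - 'X_(lshift n j) * 'X_(rshift n i).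

Definition binomial_edge_ideal (K : fieldType) (n : nat) (e : rel 'I_n) :
    {mpoly K[n + n]} -> Prop :=
  ideal_gen (fun q => exists i j : 'I_n,
    [/\ (i < j)%N, e i j & q = edge_binomial K i j]).

Arguments binomial_edge_ideal K {n} e f.

Definition closed_graph (K : fieldType) (n : nat) (e : rel 'I_n) : Prop :=
  exists gs : seq {mpoly K[n + n]},
    (forall g, g \in gs -> g \is 2.-homog) /\
    is_groebner_basis (binomial_edge_ideal K e) gs.

Arguments closed_graph K {n} e.

Definition initial_graph (n : nat) (e : rel 'I_n) : rel 'I_(n + n) :=
  fun u v => match split u, split v with
             | inl i, inr j | inr j, inl i => (i < j)%N && e i j
             | _, _ => false
             end.

Definition edge_ideal (K : fieldType) (m : nat) (h : rel 'I_m) :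
    {mpoly K[m]} -> Prop :=
  ideal_gen (fun q => exists u v : 'I_m, h u v /\ q = 'X_u * 'X_v).

Arguments edge_ideal K {m} h f.

Definition nb_cliques (n : nat) (e : rel 'I_n) (i : nat) : nat :=
  #|[set A : {set 'I_n} | (#|A| == i) &&
      [forall u in A, forall v in A, (u != v) ==> e u v]]|.

(* Main.v *)
(* Let I be generated by quadrics.  Minimality forces the generators of F_i to
   have degree at least i + 2, and reading off the linear parts of the
   differentials identifies the degree i + 2 part of F_i with the space of
   alternating tensors in V^(x i) (x) I_2 (V the span of the variables) killed
   by multiplication of the last factor of V into I_2; so beta_{i,i+2}(I) is the
   dimension of this space of "linear cycles".  Such cycles are multigraded inside
   V^(x i) (x) S_2, and the top multidegree component of a cycle of I is a cycle of
   the initial ideal.  For the edge ideal of a bipartite graph H on the x_i and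
   y_j, a multidegree carrying a nonzero cycle is squarefree and spans a complete
   bipartite induced subgraph of H, and conversely each such subgraph W carries
   exactly one cycle up to scalars, namely the sign of an ordering of W.  This
   bounds beta_{i,i+2}(J_G) and computes beta_{i,i+2}(I(in_<(G))).  Finally, when G is
   closed, in_<(J_G) = I(in_<(G)), and these subgraphs on i + 2 vertices are the
   cliques of G with i + 2 vertices cut into an initial x-part and a final y-part,
   both nonempty: i + 1 ways for each clique. *)
From HB Require Import structures.
Require Import Defs.
From mathcomp Require Import all_boot all_order all_algebra.
From mathcomp Require Import mpoly.
From mathcomp Require Import perm zify ring.
From Stdlib Require Import Classical ClassicalEpsilon.
From Stdlib Require Import FunctionalExtensionality PropExtensionality.

Set Implicit Arguments.
Unset Strict Implicit.
Unset Printing Implicit Defensive.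

Import Order.TTheory GRing.Theory.
Local Open Scope ring_scope.

(** * Finite generation of submodules of free modules *)

(** Dickson's lemma for exponent vectors [f u] indexed by an arbitrary type, so that polynomials can
    be compared through their leading exponents. Induction on the number of coordinates. *)
Lemma dickson (T : Type) (f : T -> nat -> nat) (m : nat) (P : T -> Prop) :
  exists l : seq T, (forall v, List.In v l -> P v) /\
    forall u, P u -> exists2 v, List.In v l & forall i, (i < m)%N -> (f v i <= f u i)%N.
Proof.
elim: m P => [|m IHm] P.
  case: (classic (exists v, P v)) => [[v Pv]|nP].
    by exists [:: v]; split=> [w [<-//|[]]|u _]; exists v => //; left.
  by exists [::]; split=> // u Pu; case: nP; exists u.
have [l0 [l0P l0min]] := IHm P.
(* Once the last coordinate of [u] reaches [k], the list [l0] already covers [u]; the finitely many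
   smaller values are covered slice by slice. *)
have [k fk] : exists k, forall v, List.In v l0 -> (f v m <= k)%N.
  elim: {l0P l0min} l0 => [|v l [k fk]]; first by exists 0%N.
  exists (maxn (f v m) k) => w [<-|/fk wk]; first exact: leq_maxl.
  by rewrite (leq_trans wk) ?leq_maxr.
have [l1 [l1P l1min]] : exists l : seq T, (forall v, List.In v l -> P v) /\
    forall u, P u -> (f u m < k)%N ->
      exists2 v, List.In v l & forall i, (i < m.+1)%N -> (f v i <= f u i)%N.
  elim: {l0P l0min fk} k => [|k [l1 [l1P l1min]]]; first by exists [::].
  have [l2 [l2P l2min]] := IHm (fun u => P u /\ f u m = k).
  exists (l1 ++ l2); split=> [v /(@List.in_app_or T)[/l1P|/l2P[]]//|u Pu].
  rewrite ltnS leq_eqVlt => /predU1P[fuk|fuk].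
    have [v vl2 vu] := l2min u (conj Pu fuk).
    exists v => [|i]; first by apply: List.in_or_app; right.
    by rewrite ltnS leq_eqVlt => /predU1P[->|/vu//]; have [_ ->] := l2P _ vl2; rewrite fuk.
  have [v vl1 vu] := l1min u Pu fuk.
  by exists v => //; apply: List.in_or_app; left.
exists (l0 ++ l1); split=> [v /(@List.in_app_or T)[/l0P|/l1P]//|u Pu].
have [ufk|fku] := ltnP (f u m) k.
  have [v vl1 vu] := l1min u Pu ufk.
  by exists v => //; apply: List.in_or_app; right.
have [v vl0 vu] := l0min u Pu.
exists v => [|i]; first by apply: List.in_or_app; left.
rewrite ltnS leq_eqVlt => /predU1P[->|/vu//].
exact: leq_trans (fk _ vl0) fku.
Qed.

Section Span.
Context {R : comNzRingType} {p : nat}.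
Implicit Types v : 'rV[R]_p.

Definition row_span r (N : 'M[R]_(r, p)) v : Prop := exists w, v = w *m N.

Definition submodule (P : 'rV[R]_p -> Prop) : Prop :=
  P 0 /\ forall a u v, P u -> P v -> P (a *: u + v).

Lemma row_span_submodule r (N : 'M_(r, p)) : submodule (row_span N).
Proof.
split=> [|a _ _ [u ->] [v ->]]; first by exists 0; rewrite mul0mx.
by exists (a *: u + v); rewrite mulmxDl scalemxAl.
Qed.

Lemma row_in_span r (N : 'M_(r, p)) a : row_span N (row a N).
Proof. by exists (delta_mx 0 a); rewrite rowE. Qed.

Lemma submodule_sum P (I : finType) (Q : pred I) (c : I -> R) (F : I -> 'rV_p) :
  submodule P -> (forall i, Q i -> P (F i)) -> P (\sum_(i | Q i) c i *: F i).
Proof.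
move=> [P0 PD] PF; elim/big_rec: _ => [//|i v Qi Pv].
exact: PD (PF i Qi) Pv.
Qed.

Lemma row_span_sub P r (N : 'M_(r, p)) : submodule P ->
  (forall a, P (row a N)) -> forall v, row_span N v -> P v.
Proof.
by move=> Psub PN _ [w ->]; rewrite mulmx_sum_row; apply: submodule_sum.
Qed.

End Span.

(** * Noetherianity of polynomial rings and of their free modules *)

Section Noetherian.
Context {m : nat} {K : fieldType}.
Local Notation S := {mpoly K[m]}.

Definition finitely_generated p (P : 'rV[S]_p -> Prop) : Prop :=
  exists r (N : 'M_(r, p)), forall v, P v <-> row_span N v.

(** Hilbert's basis theorem by division: Dickson's lemma yields finitely many elements whose leading
    monomials divide all others, and reduction by them lowers the leading monomial, which is
    well-founded. *)
Lemma ideal_finitely_generated (P : 'rV[S]_1 -> Prop) :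
  submodule P -> finitely_generated P.
Proof.
move=> Psub; have [P0 PD] := Psub.
pose c (f : S) i := nth 0%N (mlead f) i.
have [l [lP lmin]] := dickson c m (fun f => f <> 0 /\ P f%:M).
exists (size l), (\col_(i < size l) nth 0 l i) => v; split; last first.
  move: v; apply: row_span_sub => // a.
  have -> : row a (\col_(i < size l) nth 0 l i) = (nth 0 l a)%:M :> 'M[S]_(1, 1).
    by apply/matrixP=> i j; rewrite !mxE !ord1.
  have /lP[//] : List.In (nth 0 l a) l.
  elim: (l) (nat_of_ord a) (ltn_ord a) => [//|x s IHs] [|k] /=; first by left.
  by move=> /IHs; right.
have -> : v = (v 0 0)%:M by apply/matrixP=> i j; rewrite !mxE !ord1.
move: (v 0 0) => f {v}.
move: f; suff H u f : mlead f = u -> P f%:M -> row_span (\col_(i < size l) nth 0 l i) f%:M.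
  by move=> f; apply: H.
move: u f; apply: ltmwf => u IHu f fu Pf.
have [->|f0] := eqVneq f 0.
  by rewrite raddf0; have [] := row_span_submodule (\col_(i < size l) nth 0 l i).
have [h hl hf] := lmin f (conj (elimN eqP f0) Pf).
have [/eqP h0 Ph] := lP _ hl.
have hle : (mlead h <= mlead f)%MM.
  by apply/mnm_lepP=> i; rewrite !(mnm_nth 0%N) hf.
(* The term that makes [g * h] and [f] agree in their leading terms. *)
pose g := ((mleadc f / mleadc h) *: 'X_[mlead f - mlead h] : S).
have hc0 : mleadc h != 0 by rewrite mleadc_eq0.
have fc0 : mleadc f != 0 by rewrite mleadc_eq0.
have gc0 : mleadc f / mleadc h != 0 by rewrite mulf_neq0 ?invr_eq0.
have X0 k : 'X_[k] != 0 :> S by rewrite -mleadc_eq0 mleadXm mcoeffX eqxx oner_eq0.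
have leadg : mlead g = (mlead f - mlead h)%MM by rewrite mleadZ ?mleadXm.
have leadgh : mlead (g * h) = mlead f.
  by rewrite mleadM ?leadg ?submK // scaler_eq0 (negPf gc0) /=.
have topgh : (g * h)@_(mlead f) = mleadc f.
  rewrite -{1}leadgh mleadM ?scaler_eq0 ?(negPf gc0) //=.
  by rewrite mleadcM mleadcZE mleadXm mcoeffX eqxx mulr1 divfK.
have spanh : row_span (\col_(i < size l) nth 0 l i) h%:M.
  have [k kl <-] : exists2 k, (k < size l)%N & nth 0 l k = h.
    elim: (l) hl => [//|x s IHs] [->|/IHs[k ks <-]]; first by exists 0%N.
    by exists k.+1.
  have := row_in_span (\col_(i < size l) nth 0 l i) (Ordinal kl).
  by congr row_span; apply/matrixP=> i j; rewrite !mxE !ord1.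
have -> : f%:M = g *: h%:M + (f - g * h)%:M :> 'rV[S]_1.
  by rewrite raddfB /= scale_scalar_mx addrC subrK.
have [f'0|f'0] := eqVneq (f - g * h) 0.
  rewrite f'0 raddf0; apply: (row_span_submodule _).2 => //.
  by have [] := row_span_submodule (\col_(i < size l) nth 0 l i).
apply: (row_span_submodule _).2 => //; apply: IHu (erefl _) _.
  rewrite -fu lt_neqAle (le_trans (mleadB_le _ _)) ?leadgh ?joinxx ?lexx ?andbT //.
  apply: contra f'0 => /eqP le; rewrite -mleadc_eq0 le mcoeffB topgh subrr //.
have -> : (f - g * h)%:M = (- g) *: h%:M + f%:M :> 'rV[S]_1.
  by rewrite raddfB /= scaleNr scale_scalar_mx addrC.
exact: PD.
Qed.

(** Induction on [p]: the first coordinates form an ideal, and the elements with zero first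
    coordinate a submodule in one coordinate fewer. Lifted generators of the former and generators
    of the latter form a block-triangular matrix. *)
Lemma submodule_finitely_generated p (P : 'rV[S]_p -> Prop) :
  submodule P -> finitely_generated P.
Proof.
elim: p P => [|p IHp].
  move=> P [P0 _]; exists 0%N, 0 => v; have -> : v = 0 by apply/matrixP=> i [].
  by split=> // _; have [] := row_span_submodule (0 : 'M[S]_(0, 0)).
rewrite -[p.+1]/(1 + p)%N => P Psub; have [P0 PD] := Psub.
have [r1 [N1 N1P]] : finitely_generated (fun u : 'rV_1 => exists v : 'rV_p, P (row_mx u v)).
  apply: ideal_finitely_generated; split=> [|a u1 u2 [v1 Pv1] [v2 Pv2]].
    by exists 0; rewrite row_mx0.
  exists (a *: v1 + v2); rewrite -add_row_mx -scale_row_mx; exact: PD.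
have [r2 [N2 N2P]] : finitely_generated (fun v : 'rV_p => P (row_mx (0 : 'rV_1) v)).
  apply: IHp; split=> [|a v1 v2 Pv1 Pv2]; first by rewrite row_mx0.
  have -> : 0 = a *: 0 + 0 :> 'rV[S]_1 by rewrite scaler0 add0r.
  by rewrite -add_row_mx -scale_row_mx; apply: PD.
have [M MP] : exists M : 'M[S]_(r1, p), forall a, P (row_mx (row a N1) (row a M)).
  have lift a : exists v : 'rV[S]_p, P (row_mx (row a N1) v).
    by apply/N1P; apply: row_in_span.
  pose g a := proj1_sig (constructive_indefinite_description _ (lift a)).
  exists (\matrix_a g a) => a; rewrite rowK /g.
  by case: constructive_indefinite_description.
exists (r1 + r2)%N, (block_mx N1 M 0 N2) => v; split; last first.
  move: v; apply: row_span_sub => // a.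
  rewrite -[a]splitK; case: (split a) => j /=.
    by rewrite block_mxEv rowKu row_row_mx.
  rewrite block_mxEv rowKd row_row_mx row0; apply/N2P; exact: row_in_span.
rewrite -[v]hsubmxK => Pv.
have [w1 w1E] : row_span N1 (@lsubmx _ 1 1 p v) by apply/N1P; exists (rsubmx v).
have [w2 w2E] : row_span N2 (@rsubmx _ 1 1 p v - w1 *m M).
  apply/N2P; have -> : row_mx 0 (rsubmx v - w1 *m M) =
      (-1) *: row_mx (w1 *m N1) (w1 *m M) + row_mx (@lsubmx _ 1 1 p v) (rsubmx v).
    by rewrite scale_row_mx add_row_mx !scaleN1r w1E addNr addrC.
  apply: PD => //; rewrite -mul_mx_row mulmx_sum_row.
  by apply: submodule_sum => // a _; rewrite row_row_mx.
exists (row_mx w1 w2); rewrite mul_row_block w1E mulmx0 addr0 -w2E.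
by congr row_mx; rewrite addrC subrK.
Qed.

End Noetherian.

(** * Existence of minimal graded free resolutions *)

Section Graded.
Context {m : nat} {K : fieldType}.
Local Notation S := {mpoly K[m]}.

Lemma mcoeff_pihomog d (f : S) u :
  (pihomog mdeg d f)@_u = if mdeg u == d then f@_u else 0.
Proof.
case: eqP => [ud|/eqP ud]; last exact: dhomog_nemf_coeff (pihomogP _ _ _) ud.
have lt_u : (mdeg u < maxn (msize f) (mdeg u).+1)%N by rewrite leq_max ltnSn orbT.
have /(congr1 (mcoeff u)) fu := pihomog_partitionE (mf := mdeg) (leq_maxl (msize f) (mdeg u).+1).
rewrite fu [RHS]raddf_sum (bigD1 (Ordinal lt_u)) //= [X in _ = _ + X]big1 ?addr0 ?ud // => j ju.
apply: dhomog_nemf_coeff (pihomogP _ _ _) _.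
by apply: contra ju => /eqP uj; apply/eqP/val_inj.
Qed.

Lemma pihomogM_homog k s (f g : S) : g \is s.-homog ->
  pihomog mdeg k (f * g) = if (s <= k)%N then pihomog mdeg (k - s) f * g else 0.
Proof.
move=> gs; pose N := maxn (msize f) k.+1.
rewrite {1}(pihomog_partitionE (mf := mdeg) (leq_maxl (msize f) k.+1)).
rewrite mulr_suml raddf_sum /=.
have term j : pihomog mdeg k (pihomog mdeg j f * g) =
    if (j + s == k)%N then pihomog mdeg j f * g else 0.
  have hom : pihomog mdeg j f * g \is (j + s).-homog by apply: dhomogM => //; apply: pihomogP.
  case: eqP => [<-|/eqP]; first exact: pihomog_dE.
  by move=> ne; apply: pihomog_ne0 ne hom.
under eq_bigr do rewrite term.
have [sk|ks] := leqP s k; last first.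
  by apply: big1 => j _; rewrite gtn_eqF // ltn_addl.
have lt_ks : (k - s < N)%N by rewrite leq_max ltnS leq_subr orbT.
rewrite (bigD1 (Ordinal lt_ks)) //= subnK // eqxx big1 ?addr0 // => j jks.
case: eqP => // jsk; case/eqP: jks; apply: val_inj => /=; by rewrite -jsk addnK.
Qed.

(* The component of degree [d] of [f], seen as an element of S(-k). *)
Definition shifted_component d k (f : S) : S :=
  if (k <= d)%N then pihomog mdeg (d - k) f else 0.

Lemma shifted_component_is_linear d k : linear (shifted_component d k).
Proof.
move=> a f g; rewrite /shifted_component; case: ifP => _; first exact: linearP.
by rewrite scaler0 addr0.
Qed.

HB.instance Definition _ d k :=
  GRing.isLinear.Build K S S _ (shifted_component d k) (shifted_component_is_linear d k).

(** Multiplication by [g] is a graded map from S(-k') to S(-k), so it commutes with taking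
    components. The second hypothesis handles [k' < k], where truncated subtraction would allow a
    constant [g]. *)
Lemma shifted_componentM d k k' (f g : S) :
  g \is (k' - k).-homog -> ((k' < k)%N -> g = 0) ->
  shifted_component d k (f * g) = shifted_component d k' f * g.
Proof.
have [-> _ _|g0 ghom g_eq0] := eqVneq g 0; first by rewrite !mulr0 linear0.
have kk' : (k <= k')%N by case: leqP => // /g_eq0 gz; rewrite gz eqxx in g0.
rewrite /shifted_component (pihomogM_homog _ _ ghom).
have [kd|dk] := leqP k d; last by rewrite leqNgt (leq_trans dk) //= mul0r.
rewrite leq_sub2rE // leqNgt; case: leqP => k'd; last by rewrite mul0r.
by rewrite subnBA // subnK.
Qed.

Lemma sum_shifted_component k D (f : S) : (k + msize f <= D)%N ->
  f = \sum_(d < D) shifted_component d k f.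
Proof.
move=> kfD; have kD : (k <= D)%N by apply: leq_trans kfD; apply: leq_addr.
rewrite -(big_mkord xpredT (fun d => shifted_component d k f)) /=.
rewrite (big_cat_nat (leq0n k) kD) /= [X in _ = X + _]big_nat_cond.
rewrite [X in _ = X + _]big1 ?add0r; last first.
  by move=> d /andP[/andP[_ dk] _]; rewrite /shifted_component leqNgt dk.
rewrite -{1}[k]add0n big_addn big_mkord.
have fDk : (msize f <= D - k)%N by rewrite leq_subRL.
rewrite [LHS](pihomog_partitionE (mf := mdeg) fDk).
by apply: eq_bigr => d _; rewrite /shifted_component leq_addl addnK.
Qed.

Lemma shifted_component_coef0 d f : (shifted_component d d f) = (f@_0%MM)%:MP.
Proof.
rewrite /shifted_component leqnn subnn; apply/mpolyP=> u.
rewrite mcoeff_pihomog mcoeffC mdeg_eq0; case: eqP => [->|]; first by rewrite mulr1.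
by rewrite mulr0.
Qed.

Definition graded_mx r p (dr : 'I_r -> nat) (dp : 'I_p -> nat) (N : 'M[S]_(r, p)) :=
  forall a b, N a b \is (dr a - dp b).-homog /\ ((dr a < dp b)%N -> N a b = 0).

Definition row_component p d (dp : 'I_p -> nat) (v : 'rV[S]_p) : 'rV[S]_p :=
  \row_b shifted_component d (dp b) (v 0 b).

Lemma row_componentM r p d dr dp (N : 'M_(r, p)) w : graded_mx dr dp N ->
  row_component d dp (w *m N) = row_component d dr w *m N.
Proof.
move=> grN; apply/rowP=> b; rewrite !mxE raddf_sum; apply: eq_bigr => a _.
by have [hom z] := grN a b; rewrite mxE -(shifted_componentM d _ hom z).
Qed.

Definition graded_submodule p (dp : 'I_p -> nat) (P : 'rV[S]_p -> Prop) : Prop :=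
  submodule P /\ forall d v, P v -> P (row_component d dp v).

(** Minimality stated on syzygies: the kernel lies in the irrelevant maximal ideal times the free
    module. This becomes the vanishing of constant terms in the next differential. *)
Definition minimal_rows r p (N : 'M[S]_(r, p)) : Prop :=
  forall w : 'rV_r, w *m N = 0 -> forall a, (w 0 a)@_0%MM = 0.

(** The homogeneous components of a finite generating set generate too; [D] exceeds every degree in
    which such a component can be nonzero. *)
Lemma graded_generators p dp (P : 'rV[S]_p -> Prop) : graded_submodule dp P ->
  exists r (dr : 'I_r -> nat) (N : 'M_(r, p)),
    graded_mx dr dp N /\ forall v, P v <-> row_span N v.
Proof.
move=> [Psub Pgr]; have [r0 [N0 N0P]] := submodule_finitely_generated Psub.
pose D := (\max_(a < r0) \max_(b < p) (dp b + msize (N0 a b)))%N.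
pose T := ('I_r0 * 'I_D)%type.
pose N := \matrix_(k < #|{: T}|) row_component (enum_val k).2 dp (row (enum_val k).1 N0).
exists #|{: T}|, (fun k : 'I_#|{: T}| => nat_of_ord (enum_val k).2), N; split=> [k b|v].
  rewrite !mxE /shifted_component; split=> [|lt_d]; last by rewrite leqNgt lt_d.
  by case: ifP => _; [apply: pihomogP|apply: dhomog0].
split; last first.
  move: v; apply: row_span_sub => // k; rewrite rowK; apply: Pgr; apply/N0P.
  exact: row_in_span.
move/N0P; move: v; apply: row_span_sub (row_span_submodule _) _ => a.
have -> : row a N0 = \sum_(d < D) (1 : S) *: row_component d dp (row a N0).
  apply/rowP=> b; rewrite summxE mxE {1}(@sum_shifted_component (dp b) D (N0 a b)).
    by apply: eq_bigr => d _; rewrite !mxE mul1r.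
  apply: leq_trans (leq_bigmax a).
  exact: (leq_bigmax (F := fun b => (dp b + msize (N0 a b))%N) b).
apply: submodule_sum (row_span_submodule _) _ => d _.
have := row_in_span N (enum_rank (a, d)); by rewrite rowK enum_rankK.
Qed.

(** Induction on the number of generators. If a syzygy has a nonzero constant term at [a], its
    component of degree [dr a] is a syzygy with a unit scalar at [a], so row [a] is a combination of
    the others and is dropped. *)
Lemma minimal_graded_generators p dp (P : 'rV[S]_p -> Prop) : graded_submodule dp P ->
  exists r (dr : 'I_r -> nat) (N : 'M_(r, p)),
    [/\ graded_mx dr dp N, forall v, P v <-> row_span N v & minimal_rows N].
Proof.
move=> /graded_generators[r]; elim: r => [|r IHr] [dr [N [grN NP]]].
  by exists 0%N, dr, N; split=> // w _ [].
have [Nmin|] := classic (minimal_rows N); first by exists r.+1, dr, N.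
move=> /not_all_ex_not[w nw]; have [wN0 na] := imply_to_and _ _ nw.
have [a wa0] := not_all_ex_not _ _ na.
pose e := row_component (dr a) dr w.
have eN0 : e *m N = 0.
  rewrite -(row_componentM (dr a) w grN) wN0; apply/rowP=> b; by rewrite !mxE linear0.
have ea : e 0 a = ((w 0 a)@_0%MM)%:MP by rewrite mxE shifted_component_coef0.
have rowa : row a N = (- ((w 0 a)@_0%MM)^-1)%:MP *: \sum_(j < r) e 0 (lift a j) *: row (lift a j) N.
  have /eqP := eN0; rewrite mulmx_sum_row (bigD1_ord a) //= ea addr_eq0.
  rewrite rmorphN /= scaleNr => /eqP/(congr1 (fun z => ((w 0 a)@_0%MM)^-1%:MP *: z)).
  by rewrite scalerA -rmorphM /= mulVf ?scale1r ?scalerN //; apply/eqP.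
apply: IHr; exists (dr \o lift a), (row' a N); split=> [j b|v].
  by rewrite mxE; apply: grN.
split; last first.
  move: v; apply: row_span_sub => [|j]; last first.
    apply/NP; have -> : row j (row' a N) = row (lift a j) N by apply/rowP=> b; rewrite !mxE.
    exact: row_in_span.
  have [S0 SD] := row_span_submodule N.
  by split=> [|c u v /NP Pu /NP Pv]; apply/NP => //; apply: SD.
have rowj j : row_span (row' a N) (row (lift a j) N).
  by have := row_in_span (row' a N) j; congr row_span; apply/rowP=> b; rewrite !mxE.
move/NP; move: v; apply: row_span_sub (row_span_submodule _) _ => k.
have [k'|->] := unliftP a k; last first.
  rewrite rowa -[X in row_span _ X]addr0; apply: (row_span_submodule _).2.
    by apply: submodule_sum (row_span_submodule _) _.
  by have [] := row_span_submodule (row' a N).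
by move=> ->.
Qed.

Lemma syzygies_graded r p dr dp (N : 'M[S]_(r, p)) : graded_mx dr dp N ->
  graded_submodule dr (fun w => w *m N = 0).
Proof.
move=> grN; split=> [|d w wN]; last first.
  rewrite -(row_componentM _ _ grN) wN; apply/rowP=> b; by rewrite !mxE linear0.
split=> [|a u v uN vN]; first exact: mul0mx.
by rewrite mulmxDl -scalemxAl uN vN scaler0 addr0.
Qed.

Definition homogeneous_ideal (I : S -> Prop) : Prop :=
  [/\ I 0, forall a f g, I f -> I g -> I (a * f + g)
    & forall d f, I f -> I (pihomog mdeg d f)].

End Graded.

(** * Iterated minimal syzygies *)

Section Resolution.
Context {m : nat} {K : fieldType}.
Local Notation S := {mpoly K[m]}.

Record graded_map := GradedMap {
  gm_source : nat;
  gm_target : nat;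
  gm_source_deg : 'I_gm_source -> nat;
  gm_target_deg : 'I_gm_target -> nat;
  gm_mx : 'M[S]_(gm_source, gm_target);
  gm_graded : graded_mx gm_source_deg gm_target_deg gm_mx;
  gm_minimal : minimal_rows gm_mx }.

Definition syzygy_data (M : graded_map) :=
  {r : nat & (('I_r -> nat) * 'M[S]_(r, @gm_source M))%type}.

Lemma syzygy_data_exists (M : graded_map) : exists N : syzygy_data M,
  [/\ graded_mx (tagged N).1 (@gm_source_deg M) (tagged N).2,
      forall v, v *m gm_mx M = 0 <-> row_span (tagged N).2 v
    & minimal_rows (tagged N).2].
Proof.
have [r [dr [N NP]]] := minimal_graded_generators (syzygies_graded (@gm_graded M)).
by exists (Tagged (fun r => ('I_r -> nat) * 'M[S]_(r, gm_source M))%type (dr, N)).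
Qed.

Definition choose_syzygies M := constructive_indefinite_description _ (syzygy_data_exists M).

(* Definitional equality [gm_target (syzygy_map M) = gm_source M] is what lets
   the iterates be assembled into a complex without casts. *)
Definition syzygy_map M : graded_map :=
  let NP := proj2_sig (choose_syzygies M) in
  @GradedMap _ (gm_source M) (tagged (proj1_sig (choose_syzygies M))).1 (@gm_source_deg M)
    (tagged (proj1_sig (choose_syzygies M))).2
    (let: And3 grN _ _ := NP in grN) (let: And3 _ _ minN := NP in minN).

Lemma syzygy_mapP M (v : 'rV_(gm_source M)) :
  v *m gm_mx M = 0 <-> exists w, v = w *m gm_mx (syzygy_map M).
Proof. by rewrite /syzygy_map /=; case: (choose_syzygies M) => N []. Qed.

(** The iteration starts from minimal generators of I, seen as rows of length 1. Each differential
    is minimal because its rows are syzygies of the preceding matrix, whose rows are minimal. *)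
Lemma graded_resolution_exists (I : S -> Prop) : homogeneous_ideal I ->
  inhabited (min_graded_resolution I).
Proof.
move=> [I0 ID Ihom].
have [|r [dr [N [grN NI minN]]]] :=
  @minimal_graded_generators m K 1 (fun=> 0%N) (fun v => I (v 0 0)).
  split; first by split=> [|a u v Iu Iv]; rewrite !mxE //; apply: ID.
  by move=> d v Iv; rewrite mxE /shifted_component /= subn0; apply: Ihom.
pose st i := iter i syzygy_map (GradedMap grN minN).
exists; refine (@MinGradedResolution m K I (fun i => gm_source (st i))
  (fun i => @gm_source_deg (st i)) (gm_mx (st 0%N)) (fun i => gm_mx (st i.+1))
  _ _ _ _ _ _ _).
- by move=> a; have [] := grN a 0; rewrite subn0.
- by move=> i a b; have [] := @gm_graded (st i.+1) a b.
- by move=> i a b; have [_] := @gm_graded (st i.+1) a b.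
- move=> f; have := NI f%:M; rewrite mxE eqxx mulr1n => fI.
  split=> [/fI[w fw]|[w ->]].
    by exists w; rewrite -fw mxE eqxx.
  by apply/(NI (w *m N)); exists w.
- by move=> v; apply: (@syzygy_mapP (st 0%N)).
- by move=> i v; apply: (@syzygy_mapP (st i.+1)).
- move=> i a b; suff /(@gm_minimal (st i))/(_ b) : row a (gm_mx (st i.+1)) *m gm_mx (st i) = 0.
    by rewrite mxE.
  apply/(@syzygy_mapP (st i)).
  exact: row_in_span.
Qed.

End Resolution.

(** * The linear strand of a resolution *)

Section LinearCycles.
Context {m : nat} {K : fieldType}.
Local Notation S := {mpoly K[m]}.

Lemma sum_linear_form (f : S) : f \is 1.-homog ->
  f = \sum_u (f@_U_(u))%:MP * 'X_u.
Proof.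
move=> f1; apply/mpolyP=> w; rewrite raddf_sum /=.
under eq_bigr do rewrite mcoeffCM mcoeffX.
have [/mdeg1P[u /eqP->]|w1] := boolP (mdeg w == 1%N).
  rewrite (bigD1 u) //= eqxx mulr1 big1 ?addr0 // => v vu.
  by rewrite eq_mnm1 (negPf vu) mulr0.
rewrite (dhomog_nemf_coeff f1 w1) big1 // => u _.
by case: eqP => [uw|_]; rewrite ?mulr0 //; rewrite -uw mdeg1 in w1.
Qed.

Lemma mnm1D_eq (u v p q : 'I_m) : (U_(u) + U_(v) == U_(p) + U_(q))%MM =
  ((u == p) && (v == q)) || ((u == q) && (v == p)).
Proof.
have [<-|up] := eqVneq u p.
  rewrite eqm_add2l eq_mnm1 /=; case: (v =P q) => //= vq.
  by apply/esym/negP=> /andP[/eqP uq /eqP vu]; case: vq; rewrite vu.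
have [<-|uq] /= := eqVneq u q; first by rewrite addmC eqm_add2r eq_mnm1.
apply/negP=> /eqP/mnmP/(_ u); rewrite !mnmDE !mnm1E eqxx.
by rewrite (eq_sym p) (eq_sym q) (negPf up) (negPf uq).
Qed.

(** The coefficient of x_u x_v is a u v + a v u off the diagonal and a u u on it. The diagonal is
    stated apart because antisymmetry does not make it vanish in characteristic 2. *)
Lemma quadratic_form_eq0 (a : 'I_m -> 'I_m -> K) :
  \sum_u \sum_v (a u v)%:MP * ('X_u * 'X_v) = 0 :> S ->
  forall u v, a u v = - a v u /\ a u u = 0.
Proof.
move=> sum0; have coef p q : \sum_u \sum_v a u v * (U_(u) + U_(v) == U_(p) + U_(q))%MM%:R = 0.
  rewrite -[RHS](mcoeff0 K (U_(p) + U_(q))%MM) -sum0 [RHS]raddf_sum.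
  apply: eq_bigr => u _; rewrite [RHS]raddf_sum; apply: eq_bigr => v _.
  by rewrite /= mcoeffCM -mpolyXD mcoeffX.
have diag p : a p p = 0.
  rewrite -[RHS](coef p p) (bigD1 p) //= (bigD1 p) //= mnm1D_eq eqxx mulr1.
  rewrite !big1 ?addr0 // => u up; last first.
    by rewrite mnm1D_eq eqxx (negPf up) mulr0.
  by rewrite big1 // => v _; rewrite mnm1D_eq (negPf up) mulr0.
move=> u v; split=> //; have [<-|uv] := eqVneq u v; first by rewrite diag oppr0.
apply/eqP; rewrite -addr_eq0 -[X in _ == X](coef u v); apply/eqP.
have inner w : \sum_x a w x * (U_(w) + U_(x) == U_(u) + U_(v))%MM%:R =
    if w == u then a u v else if w == v then a v u else 0.
  have [->|wu] := eqVneq w u.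
    rewrite (bigD1 v) //= mnm1D_eq !eqxx mulr1 big1 ?addr0 // => x xv.
    by rewrite mnm1D_eq (negPf xv) (negPf uv) andbF mulr0.
  have [->|wv] := eqVneq w v.
    rewrite (bigD1 u) //= mnm1D_eq !eqxx orbT mulr1 big1 ?addr0 // => x xu.
    by rewrite mnm1D_eq (negPf xu) andbF orbF eq_sym (negPf uv) mulr0.
  by rewrite big1 // => x _; rewrite mnm1D_eq (negPf wu) (negPf wv) mulr0.
under eq_bigr => w _ do rewrite inner.
have vu : v != u by rewrite eq_sym.
rewrite (bigD1 u) //= eqxx (bigD1 v) //= eqxx (negPf vu).
by rewrite big1 ?addr0 // => w /andP[/negPf-> /negPf->].
Qed.

Lemma alternating_sum_eq0 (V : zmodType) k (g : 'I_k -> 'I_k -> V) :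
  (forall u v, g u v = - g v u) -> (forall u, g u u = 0) -> \sum_u \sum_v g u v = 0.
Proof.
move=> gN g0.
have split3 u : \sum_v g u v = \sum_(v < k | (v < u)%N) g u v + \sum_(v < k | (u < v)%N) g u v.
  rewrite (bigID (fun v : 'I_k => v < u)%N) /=; congr (_ + _).
  rewrite (bigD1 u) ?ltnn //= g0 add0r; apply: eq_bigl => v.
  by rewrite -leqNgt andbC [RHS]ltn_neqAle eq_sym.
under eq_bigr do rewrite split3.
rewrite big_split /= [X in _ + X](exchange_big_dep xpredT) //= -big_split big1 // => u _.
by rewrite /= -big_split big1 // => v _; rewrite /= gN addNr.
Qed.

(* Tensors in V^(x i) (x) I_2, with V the span of the variables, given by their
   coordinates; only the values on words of length [i] matter. *)
Record linear_cycle (I : S -> Prop) (i : nat) (t : seq 'I_m -> S) : Prop := LinearCycle {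
  cycle_in_ideal : forall s, size s = i -> I (t s);
  cycle_homog : forall s, size s = i -> t s \is 2.-homog;
  cycle_swap : forall s1 u v s2, size (s1 ++ u :: v :: s2) = i ->
    t (s1 ++ u :: v :: s2) = - t (s1 ++ v :: u :: s2);
  cycle_repeat : forall s1 u s2, size (s1 ++ u :: u :: s2) = i ->
    t (s1 ++ u :: u :: s2) = 0;
  cycle_closed : forall s, (size s).+1 = i ->
    \sum_v 'X_v * t (rcons s v) = 0 }.

End LinearCycles.

(** * The linear strand identified with the space of linear cycles *)

Section LinearStrand.
Context {m : nat} {K : fieldType}.
Local Notation S := {mpoly K[m]}.
Context {I : S -> Prop} (F : min_graded_resolution I).
Hypothesis I_deg2 : forall f u, I f -> (mdeg u < 2)%N -> f@_u = 0.

Local Notation rk := (mgr_rank F).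
Local Notation cst := (map_mx (@mpolyC m K)).

Lemma mcoeff0_mulmx_diff i (w : 'rV_(rk i.+1)) b : ((w *m mgr_diff F i) 0 b)@_0%MM = 0.
Proof.
rewrite mxE raddf_sum big1 // => a _.
by rewrite /= rmorphM /= mgr_minimal mulr0.
Qed.

(** A constant vector in the kernel is a boundary, and boundaries have no constant terms by
    minimality. *)
Lemma const_gen_inj (c : 'rV[K]_(rk 0)) : cst c *m mgr_gen F = 0 -> c = 0.
Proof.
move/mgr_exact0 => [w cw]; apply/rowP=> a.
have := mcoeff0_mulmx_diff w a.
by rewrite -cw !mxE mpolyCK.
Qed.

Lemma const_diff_inj i (c : 'rV[K]_(rk i.+1)) : cst c *m mgr_diff F i = 0 -> c = 0.
Proof.
move/mgr_exactS => [w cw]; apply/rowP=> a.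
have := mcoeff0_mulmx_diff w a.
by rewrite -cw !mxE mpolyCK.
Qed.

Lemma map_delta_mpolyC k (a : 'I_k) : cst (delta_mx 0 a : 'rV[K]_k) = delta_mx 0 a.
Proof. by apply/rowP=> b; rewrite !mxE; case: (_ && _); rewrite ?mpolyC1 ?mpolyC0. Qed.

Lemma delta_neq0 k (a : 'I_k) : delta_mx 0 a != 0 :> 'rV[K]_k.
Proof. by apply/eqP=> /rowP/(_ a); rewrite !mxE !eqxx => /eqP; rewrite oner_eq0. Qed.

Lemma gen_in_ideal a : I (mgr_gen F a 0).
Proof. by apply/(mgr_surj F); exists (delta_mx 0 a); rewrite -rowE mxE. Qed.

(** A basis element of smaller degree would be sent to 0, by degree reasons and minimality, against
    the injectivity on constant vectors. *)
Lemma mgr_deg_ge i (a : 'I_(rk i)) : (i.+2 <= mgr_deg a)%N.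
Proof.
elim: i a => [|i IHi] a; rewrite leqNgt; apply/negP=> lt_a.
  have /eqP[] := delta_neq0 a; apply: const_gen_inj.
  rewrite map_delta_mpolyC -rowE; apply/matrixP=> x y; rewrite !mxE !ord1.
  apply/mpolyP=> u; rewrite mcoeff0.
  have [u2|u2] := ltnP (mdeg u) 2; first exact: I_deg2 (gen_in_ideal a) u2.
  by apply: dhomog_nemf_coeff (mgr_gen_homog a) _; rewrite gtn_eqF // (leq_trans lt_a).
have /eqP[] := delta_neq0 a; apply: const_diff_inj.
rewrite map_delta_mpolyC -rowE; apply/rowP=> b; rewrite !mxE.
have ab : (mgr_deg a <= mgr_deg b)%N by apply: leq_trans (IHi b).
have [/mgr_diff_lt//|ba] := ltnP (mgr_deg a) (mgr_deg b).
apply/mpolyP=> u; rewrite mcoeff0.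
have [/eqP|u0] := boolP (mdeg u == 0%N).
  by move/eqP; rewrite mdeg_eq0 => /eqP->; apply: mgr_minimal.
apply: dhomog_nemf_coeff (mgr_diff_homog a b) _.
by rewrite (eqP (_ : mgr_deg a - mgr_deg b == 0)%N) // subn_eq0.
Qed.

Definition linear_part i u : 'M[K]_(rk i.+1, rk i) :=
  map_mx (mcoeff U_(u)) (mgr_diff F i).

Definition in_strand i (c : 'rV[K]_(rk i)) : Prop :=
  forall a, c 0 a != 0 -> mgr_deg a = i.+2.

Lemma linear_part_neq0 i u a b : linear_part i u a b != 0 -> mgr_deg a = (mgr_deg b).+1.
Proof.
rewrite mxE => nz; have [/mgr_diff_lt z|ba] := ltnP (mgr_deg a) (mgr_deg b).
  by rewrite z mcoeff0 eqxx in nz.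
have /eqP e : mdeg (U_(u) : 'X_{1..m}) == (mgr_deg a - mgr_deg b)%N.
  by apply: contraNT nz => ne; apply/eqP; apply: dhomog_nemf_coeff (mgr_diff_homog a b) ne.
by rewrite -(subnK ba) -e mdeg1.
Qed.

Lemma in_strand_linear_part i (c : 'rV[K]_(rk i.+1)) u :
  in_strand c -> in_strand (c *m linear_part i u).
Proof.
move=> cs b; rewrite mxE => nz.
have [a nza] : exists a, c 0 a * linear_part i u a b != 0.
  apply/existsP; apply: contraNT nz; rewrite negb_exists => /forallP z.
  by rewrite big1 // => a _; apply/eqP; have := z a; rewrite negbK.
move: nza; rewrite mulf_eq0 negb_or => /andP[/cs ca /linear_part_neq0].
by rewrite ca => -[].
Qed.

(** From degree i+3 the matrix entries are linear forms towards degree i+2, constants towards degree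
    i+3, and zero towards higher degrees; the constants vanish by minimality. *)
Lemma strand_diff i (c : 'rV[K]_(rk i.+1)) : in_strand c ->
  cst c *m mgr_diff F i = \sum_u 'X_u *: cst (c *m linear_part i u).
Proof.
move=> cs; apply/rowP=> b; rewrite summxE mxE.
under [RHS]eq_bigr => u _ do rewrite !mxE raddf_sum mulr_sumr.
rewrite exchange_big /=; apply: eq_bigr => a _; rewrite mxE.
have [->|/cs ca] := eqVneq (c 0 a) 0.
  by rewrite mpolyC0 mul0r big1 // => u _; rewrite mul0r mpolyC0 mulr0.
have dE : mgr_diff F i a b = \sum_u ((mgr_diff F i a b)@_U_(u))%:MP * 'X_u.
  have [/mgr_diff_lt ->|ba] := ltnP (mgr_deg a) (mgr_deg b).
    by rewrite big1 // => u _; rewrite mcoeff0 mpolyC0 mul0r.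
  have := mgr_diff_homog a b; have := mgr_deg_ge b.
  rewrite ca leq_eqVlt => /predU1P[<-|b3]; first by rewrite subSnn; apply: sum_linear_form.
  have -> : mgr_deg b = i.+3 by apply/eqP; rewrite eqn_leq b3 -ca ba.
  rewrite subnn => h0; have -> : mgr_diff F i a b = 0; last first.
    by rewrite big1 // => u _; rewrite mcoeff0 mpolyC0 mul0r.
  apply/mpolyP=> u; rewrite mcoeff0; have [u0|] := boolP (mdeg u == 0%N).
    by move: u0; rewrite mdeg_eq0 => /eqP->; apply: mgr_minimal.
  exact: dhomog_nemf_coeff h0.
rewrite [in LHS]dE mulr_sumr; apply: eq_bigr => u _; rewrite !mxE mpolyCM.
by rewrite mulrA mulrC.
Qed.

(** The coordinate at the word [s] of the tensor attached to [c]: the linear parts are applied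
    letter by letter, then the generators. The value on a word that is too short is a dummy. *)
Fixpoint strand_eval i : seq 'I_m -> 'rV[K]_(rk i) -> S :=
  match i with
  | 0 => fun _ c => (cst c *m mgr_gen F) 0 0
  | i'.+1 => fun s c => if s is u :: s' then strand_eval s' (c *m linear_part i' u) else 0
  end.

Lemma strand_eval_is_linear i s : linear (@strand_eval i s).
Proof.
elim: i s => [|i IHi] [|u s] a c d /=; rewrite ?scaler0 ?addr0 //; last first.
  by rewrite mulmxDl -scalemxAl IHi.
all: have -> : cst (a *: c + d) = a%:MP *: cst c + cst d
  by apply/rowP=> b; rewrite !mxE mpolyCD mpolyCM.
all: by rewrite mulmxDl -scalemxAl !mxE mul_mpolyC.
Qed.

HB.instance Definition _ i s :=
  GRing.isLinear.Build K 'rV[K]_(rk i) S _ (@strand_eval i s) (@strand_eval_is_linear i s).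

(** Two consecutive differentials compose to zero; on the strand this is a vanishing quadratic form
    in the variables. *)
Lemma linear_part_swap i (c : 'rV[K]_(rk i.+2)) u v : in_strand c ->
  c *m linear_part i.+1 u *m linear_part i v = - (c *m linear_part i.+1 v *m linear_part i u) /\
  c *m linear_part i.+1 u *m linear_part i u = 0.
Proof.
move=> cs; pose a b u v := (c *m linear_part i.+1 u *m linear_part i v) 0 b.
have a_sym b : a b u v = - a b v u /\ a b u u = 0.
  apply: (quadratic_form_eq0 (a := a b)).
  have /rowP/(_ b) : cst c *m mgr_diff F i.+1 *m mgr_diff F i = 0.
    by apply/mgr_exactS; exists (cst c).
  rewrite (strand_diff cs) mulmx_suml summxE mxE => comp0; rewrite -[RHS]comp0.
  apply: eq_bigr => w _.
  rewrite -scalemxAl (strand_diff (in_strand_linear_part cs)) mxE summxE mulr_sumr.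
  by apply: eq_bigr => x _; rewrite mxE [X in _ = _ * (_ * X)]mxE mulrC -mulrA.
split; apply/rowP=> b; have [ab1 ab2] := a_sym b; last by rewrite [RHS]mxE; exact: ab2.
by rewrite [RHS]mxE; exact: ab1.
Qed.

Lemma strand_eval_swap i (c : 'rV[K]_(rk i)) s1 u v s2 : in_strand c ->
  size (s1 ++ u :: v :: s2) = i ->
  strand_eval (s1 ++ u :: v :: s2) c = - strand_eval (s1 ++ v :: u :: s2) c /\
  strand_eval (s1 ++ u :: u :: s2) c = 0.
Proof.
elim: s1 i c => [|w s1 IHs] [|i] c cs //=.
  case: i c cs => // i c cs _ /=.
  have [-> ->] := linear_part_swap u v cs.
  by rewrite linearN linear0.
by move=> [sz]; apply: IHs => //; apply: in_strand_linear_part.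
Qed.

Lemma strand_eval_homog i (c : 'rV[K]_(rk i)) s : in_strand c -> size s = i ->
  I (strand_eval s c) /\ strand_eval s c \is 2.-homog.
Proof.
elim: i c s => [|i IHi] c [|u s] cs //= => [_|[sz]]; last first.
  by apply: IHi => //; apply: in_strand_linear_part.
split; first by apply/(mgr_surj F); exists (cst c).
rewrite mxE; apply: rpred_sum => a _; rewrite mxE mul_mpolyC.
have [->|/cs ca] := eqVneq (c 0 a) 0; first by rewrite scale0r; apply: dhomog0.
by apply: dhomogZ; have := mgr_gen_homog a; rewrite ca.
Qed.

Lemma strand_eval_closed i (c : 'rV[K]_(rk i)) s : in_strand c -> (size s).+1 = i ->
  \sum_v 'X_v * strand_eval (rcons s v) c = 0.
Proof.
elim: i c s => [|i IHi] c s cs //= [sz].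
case: s sz => [|w s] /= sz; last first.
  by rewrite IHi //; apply: in_strand_linear_part.
case: i sz c cs {IHi} => // _ c cs.
have /matrixP/(_ 0 0) : cst c *m mgr_diff F 0 *m mgr_gen F = 0.
  by apply/mgr_exact0; exists (cst c).
rewrite (strand_diff cs) mulmx_suml summxE mxE => comp0; rewrite -[RHS]comp0.
by apply: eq_bigr => u _; rewrite -scalemxAl mxE.
Qed.

Lemma strand_eval_cycle i (c : 'rV[K]_(rk i)) : in_strand c ->
  linear_cycle I i (fun s => strand_eval s c).
Proof.
move=> cs; split=> [s sz|s sz|s1 u v s2 sz|s1 u s2 sz|s sz].
- by have [] := strand_eval_homog cs sz.
- by have [] := strand_eval_homog cs sz.
- by have [] := strand_eval_swap cs sz.
- by have [] := strand_eval_swap cs sz.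
- exact: strand_eval_closed.
Qed.

(** By induction every linear part kills [c], hence so does the differential, which is injective on
    constant vectors. *)
Lemma strand_eval_inj i (c : 'rV[K]_(rk i)) : in_strand c ->
  (forall s, size s = i -> strand_eval s c = 0) -> c = 0.
Proof.
elim: i c => [|i IHi] c cs c0.
  by apply: const_gen_inj; apply/matrixP=> x y; rewrite !ord1 [RHS]mxE; exact: (c0 [::]).
apply: const_diff_inj; rewrite (strand_diff cs) big1 // => u _.
rewrite (IHi (c *m linear_part i u)) ?map_mx0 ?scaler0 //.
  exact: in_strand_linear_part.
by move=> s sz; apply: (c0 (u :: s)); rewrite /= sz.
Qed.

Lemma mcoeffM_low d (f g : S) u : (forall v, (mdeg v < d)%N -> g@_v = 0) ->
  mdeg u = d -> (f * g)@_u = f@_0%MM * g@_u.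
Proof.
move=> g0 ud; rewrite mcoeffM.
have u_lt : (mdeg u < (mdeg u).+1)%N by [].
have z_lt : (mdeg (0%MM : 'X_{1..m}) < (mdeg u).+1)%N by rewrite mdeg0.
rewrite (bigD1 (BMultinom z_lt, BMultinom u_lt)) /= ?add0m // big1 ?addr0 //.
move=> [[v vlt] [w wlt]] /= /andP[/eqP uvw ne].
rewrite g0 ?mulr0 // -ud uvw mdegD -[X in (X < _)%N]add0n ltn_add2r lt0n mdeg_eq0.
apply: contra ne => /eqP v0; rewrite xpair_eqE -!val_eqE /=.
by rewrite uvw v0 add0m !eqxx.
Qed.

(** Induction on i: fixing the first letter u of the words leaves a shorter cycle, hence a strand
    vector [c u]. The vectors [c u] are then the linear parts of a single vector, found by
    exactness. *)
Lemma strand_eval_surj i t : linear_cycle I i t ->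
  exists2 c : 'rV[K]_(rk i), in_strand c & forall s, size s = i -> strand_eval s c = t s.
Proof.
elim: i t => [|i IHi] t [tI thom tswap trep tclosed].
  have /(mgr_surj F)[w wE] := tI [::] erefl.
  pose c := \row_a (if mgr_deg a == 2 then (w 0 a)@_0%MM else 0) : 'rV[K]_(rk 0).
  exists c => [a|[|//] _ /=]; first by rewrite mxE; case: ifP => [/eqP//|_]; rewrite eqxx.
  have cs : in_strand c by move=> a; rewrite mxE; case: ifP => [/eqP//|_]; rewrite eqxx.
  apply/mpolyP=> u; have [u2|u2] := boolP (mdeg u == 2); last first.
    have [_ hc] := strand_eval_homog (s := [::]) cs erefl.
    by rewrite (dhomog_nemf_coeff (thom [::] erefl) u2) (dhomog_nemf_coeff hc u2).
  rewrite wE !mxE !raddf_sum; apply: eq_bigr => a _ /=; rewrite !mxE mcoeffCM.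
  rewrite (mcoeffM_low (d := 2)) ?(eqP u2) //.
    case: ifP => // /negbT da; rewrite (dhomog_nemf_coeff (mgr_gen_homog a)) ?mulr0 //.
    by apply: contra da => /eqP <-; exact: u2.
  by move=> v; apply: I_deg2 (gen_in_ideal a).
have /fin_all_exists2[c cs ct] : forall u, exists2 c : 'rV[K]_(rk i), in_strand c &
    forall s, size s = i -> strand_eval s c = t (u :: s).
  move=> u; apply: IHi; split=> [s sz|s sz|s1 v w s2 sz|s1 v s2 sz|s sz].
  - by apply: tI; rewrite /= sz.
  - by apply: thom; rewrite /= sz.
  - by apply: (tswap (u :: s1)); rewrite /= sz.
  - by apply: (trep (u :: s1)); rewrite /= sz.
  - by apply: (tclosed (u :: s)); rewrite /= sz.
have [w wE] : exists w : 'rV_(rk i.+1), \sum_u 'X_u *: cst (c u) = w *m mgr_diff F i.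
  (* The sum of the x_u [c u] is a syzygy: at the first stage this is closedness of [t]; later,
     alternation of [t] and injectivity make the linear parts of the [c u] alternate. *)
  case: i {IHi} t tI thom tswap trep tclosed c cs ct => [|i] t tI thom tswap trep tclosed c cs ct.
    apply/mgr_exact0; apply/matrixP=> x y; rewrite !ord1 mulmx_suml summxE [RHS]mxE.
    rewrite -[RHS](tclosed [::] erefl); apply: eq_bigr => u _.
    by rewrite -scalemxAl mxE -(ct u [::]).
  have swap0 u v : c u *m linear_part i v = - (c v *m linear_part i u) /\
                   c u *m linear_part i u = 0.
    split.
      apply/eqP; rewrite -addr_eq0; apply/eqP; apply: strand_eval_inj => [b|s sz].
        rewrite mxE => nz; have [z|/(in_strand_linear_part (cs u))//] :=
          eqVneq ((c u *m linear_part i v) 0 b) 0.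
        by move: nz; rewrite z add0r; apply: (in_strand_linear_part (cs v)).
      rewrite linearD.
      have /= -> := ct u (v :: s) (congr1 succn sz); have /= -> := ct v (u :: s) (congr1 succn sz).
      by rewrite (tswap [::] u v s) ?addNr //= sz.
    apply: strand_eval_inj => [|s sz]; first exact: in_strand_linear_part.
    by have /= -> := ct u (u :: s) (congr1 succn sz); rewrite (trep [::]) //= sz.
  apply/mgr_exactS; apply/rowP=> b; rewrite mulmx_suml summxE [RHS]mxE.
  under eq_bigr => u _ do rewrite -scalemxAl (strand_diff (cs u)) mxE summxE mulr_sumr.
  apply: alternating_sum_eq0 => [u v|u]; have [swapu repu] := swap0 u u.
    have [-> _] := swap0 u v.
    by rewrite [X in _ * X]mxE [X in _ * (_ * X)]mxE [X in _ = - (_ * X)]mxE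
      [X in _ = - (_ * (_ * X))]mxE [X in X%:MP]mxE mpolyCN mulrN mulrN mulrCA.
  by rewrite repu map_mx0 scaler0 mxE mulr0.
(* Only the constant terms of [w] at degree i+3 are kept: they alone contribute to linear terms at
   basis elements of degree i+2. *)
exists (\row_a (if mgr_deg a == i.+3 then (w 0 a)@_0%MM else 0)) => [a|].
  by rewrite mxE; case: ifP => [/eqP//|_]; rewrite eqxx.
case=> [//|u s] [sz] /=; rewrite -(ct u s sz); congr (strand_eval s).
apply/rowP=> b; have [bi|bi] := eqVneq (mgr_deg b) i.+2; last first.
  transitivity (0 : K); last by apply/esym/eqP; apply: contraNT bi => /cs->.
  rewrite mxE big1 // => a _; rewrite mxE; case: ifP => [/eqP ai|_]; last by rewrite mul0r.
  have [->|/linear_part_neq0] := eqVneq (linear_part i u a b) 0; first by rewrite mulr0.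
  by rewrite ai => -[/eqP]; rewrite eq_sym (negPf bi).
have /rowP/(_ b)/(congr1 (mcoeff U_(u))) := wE.
rewrite summxE raddf_sum /= (bigD1 u) //= big1 ?addr0 => [|v vu]; last first.
  by rewrite !mxE mulrC mcoeffCM mcoeffXU (negPf vu) mulr0.
rewrite mxE mxE mulrC mcoeffCM mcoeffXU eqxx mulr1 => ->.
rewrite !mxE raddf_sum; apply: eq_bigr => a _; rewrite /= !mxE.
rewrite (mcoeffM_low (d := 1)) ?mdeg1 //; last first.
  by move=> v; rewrite ltnS leqn0 mdeg_eq0 => /eqP->; apply: mgr_minimal.
case: ifP => // /eqP ai; rewrite mul0r.
have [z|/linear_part_neq0] := eqVneq (linear_part i u a b) 0; last by rewrite bi.
by move: z; rewrite mxE => ->; rewrite mulr0.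
Qed.

Definition strand_basis_vector i (x : 'rV[K]_(resolution_betti F i i.+2)) : 'rV[K]_(rk i) :=
  \sum_j x 0 j *: delta_mx 0 (enum_val j).

Lemma in_strand_basis_vector i x : in_strand (@strand_basis_vector i x).
Proof.
move=> a; apply: contraNeq => ai; rewrite summxE big1 // => j _.
rewrite !mxE /=; case: eqP => [aj|_]; rewrite ?mulr0 //.
by have := enum_valP j; rewrite -aj inE (negPf ai).
Qed.

Lemma strand_basis_vector_surj i (c : 'rV[K]_(rk i)) : in_strand c ->
  exists x, c = strand_basis_vector x.
Proof.
move=> cs; exists (\row_j c 0 (enum_val j)); apply/rowP=> a; rewrite summxE.
have [ai|ai] := boolP (a \in [set a : 'I_(rk i) | mgr_deg a == i.+2]).
  rewrite (bigD1 (enum_rank_in ai a)) //= !mxE enum_rankK_in // !eqxx mulr1.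
  rewrite big1 ?addr0 // => j ja; rewrite !mxE /=; case: eqP => [aj|]; rewrite ?mulr0 //.
  by case/eqP: ja; apply: enum_val_inj; rewrite enum_rankK_in.
rewrite big1 => [|j _]; last first.
  rewrite !mxE /=; case: eqP => [aj|]; rewrite ?mulr0 //.
  by have := enum_valP j; rewrite -aj (negPf ai).
by have [//|/cs ai'] := eqVneq (c 0 a) 0; rewrite inE ai' eqxx in ai.
Qed.

Lemma strand_basis_vector_inj i (x : 'rV_(resolution_betti F i i.+2)) :
  strand_basis_vector x = 0 -> x = 0.
Proof.
move=> /rowP x0; apply/rowP=> j; have := x0 (enum_val j); rewrite summxE (bigD1 j) //=.
rewrite !mxE !eqxx mulr1 big1 ?addr0 // => k kj; rewrite !mxE /=.
case: eqP => [/enum_val_inj jk|]; last by rewrite mulr0.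
by rewrite jk eqxx in kj.
Qed.

Section Coordinates.
Context {T : finType} (i : nat) (place : T -> seq 'I_m * 'X_{1..m}).

(** A place is a word together with a monomial, so it selects one scalar of a cycle. *)
Definition cycle_coordinate (t : seq 'I_m -> S) (W : T) : K :=
  (t (place W).1)@_((place W).2).

Definition coordinate_mx : 'M[K]_(resolution_betti F i i.+2, #|T|) :=
  \matrix_(j, k) cycle_coordinate
    (fun s => strand_eval s (delta_mx 0 (enum_val j) : 'rV[K]_(rk i))) (enum_val k).

Lemma mul_coordinate_mx x k : (x *m coordinate_mx) 0 k =
  cycle_coordinate (fun s => strand_eval s (strand_basis_vector x)) (enum_val k).
Proof.
rewrite mxE /cycle_coordinate !raddf_sum; apply: eq_bigr => j _ /=.
by rewrite linearZ mcoeffZ !mxE.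
Qed.

(** If the chosen coordinates separate cycles, the coordinate matrix has independent rows, and its
    rank is at most its number of columns. *)
Lemma betti_le_coordinates :
  (forall t, linear_cycle I i t -> (forall W, cycle_coordinate t W = 0) ->
    forall s, size s = i -> t s = 0) ->
  (resolution_betti F i i.+2 <= #|T|)%N.
Proof.
move=> Tinj; suff /eqP <- : row_free coordinate_mx by apply: rank_leq_col.
apply/inj_row_free => x xE0; apply: strand_basis_vector_inj.
have cs := in_strand_basis_vector (x := x).
apply: strand_eval_inj => // s sz.
apply: (Tinj _ (strand_eval_cycle cs)) => // W.
by have /rowP/(_ (enum_rank W)) := xE0; rewrite mul_coordinate_mx enum_rankK mxE.
Qed.

(** A family of cycles dual to the coordinates gives a left inverse of the coordinate matrix, which
    bounds the number of coordinates by its number of rows. *)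
Lemma coordinates_le_betti (t : T -> seq 'I_m -> S) :
  (forall W, linear_cycle I i (t W)) -> (forall W, size (place W).1 = i) ->
  (forall W W', cycle_coordinate (t W) W' = (W == W')%:R) ->
  (#|T| <= resolution_betti F i i.+2)%N.
Proof.
move=> tcycle placeP tcoord.
have /fin_all_exists[x xP] : forall W, exists x : 'rV_(resolution_betti F i i.+2),
    forall s, size s = i -> strand_eval s (strand_basis_vector x) = t W s.
  move=> W; have [c cs ct] := strand_eval_surj (tcycle W).
  by have [x cx] := strand_basis_vector_surj cs; exists x => s /ct; rewrite cx.
pose C := \matrix_(k < #|T|) x (enum_val k).
have C1 : C *m coordinate_mx = 1%:M.
  apply/row_matrixP=> k; apply/rowP=> l; rewrite row_mul mul_coordinate_mx rowK.
  by rewrite /cycle_coordinate xP // -/(cycle_coordinate _ _) tcoord !mxE (inj_eq enum_val_inj).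
by rewrite -[X in (X <= _)%N](mxrank1 K) -C1 (leq_trans (mxrankM_maxl _ _)) ?rank_leq_col.
Qed.

End Coordinates.

End LinearStrand.

(** * Cycles are determined on complete bipartite subgraphs *)

Section PermSwap.
Context {T : eqType}.

(** Adjacent swaps generate all rearrangements: [front] bubbles a letter forward, and the target
    word is built letter by letter behind the prefix [s0]. *)
Lemma perm_swap_closed (P : seq T -> Prop) :
  (forall s1 u v s2, P (s1 ++ u :: v :: s2) -> P (s1 ++ v :: u :: s2)) ->
  forall s s', perm_eq s s' -> P s -> P s'.
Proof.
move=> Pswap.
have front s0 a x b : P (s0 ++ a ++ x :: b) -> P (s0 ++ x :: a ++ b).
  elim/last_ind: a b => [//|a y IHa] b.
  by rewrite cat_rcons catA => /Pswap; rewrite -catA => /IHa; rewrite cat_rcons.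
suff H s' s0 s : perm_eq s s' -> P (s0 ++ s) -> P (s0 ++ s') by move=> s s'; apply: (H s' [::]).
elim: s' s0 s => [|x s' IHs'] s0 s; first by move/perm_nilP->.
move=> ss'; have xs : x \in s by rewrite (perm_mem ss') mem_head.
case/path.splitPr: xs ss' => a b.
rewrite -[x :: b]/([:: x] ++ b) perm_catCA /= perm_cons => abs' /front.
by rewrite -cat_rcons -[s0 ++ x :: s']cat_rcons; apply: IHs'.
Qed.

Lemma not_uniq_perm (s : seq T) : ~~ uniq s -> exists x s', perm_eq s (x :: x :: s').
Proof.
elim: s => [//|a s IHs] /=; rewrite negb_and negbK => /orP[/perm_to_rem as_|/IHs[x [s' ss']]].
  by exists a, (rem a s); rewrite perm_cons.
exists x, (a :: s'); rewrite -(perm_cons a) in ss'; apply: perm_trans ss' _.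
by rewrite -[a :: _]/([:: a] ++ [:: x; x] ++ s') perm_catCA.
Qed.

End PermSwap.

Section Bipartite.
Context {n : nat}.
Local Notation V := 'I_(n + n).

Definition X_ (p : 'I_n) : V := lshift n p.
Definition Y_ (q : 'I_n) : V := rshift n q.
Definition XY p q : 'X_{1..n + n} := (U_(X_ p) + U_(Y_ q))%MM.

Lemma X_inj : injective X_. Proof. exact: lshift_inj. Qed.
Lemma Y_inj : injective Y_. Proof. exact: rshift_inj. Qed.
Lemma XY_neq p q : (X_ p == Y_ q) = false. Proof. exact: eq_lrshift. Qed.
Lemma YX_neq p q : (Y_ q == X_ p) = false. Proof. exact: eq_rlshift. Qed.

Lemma XY_inj p q p' q' : XY p q = XY p' q' -> p = p' /\ q = q'.
Proof.
by move/eqP; rewrite mnm1D_eq XY_neq /= orbF => /andP[/eqP/X_inj-> /eqP/Y_inj->].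
Qed.

(* Vertex sets of the induced complete bipartite subgraphs of in_<(G) that have
   k vertices and meet both sides. *)
Definition bicomplete (e : rel 'I_n) (k : nat) (W : {set V}) : bool :=
  [&& #|W| == k, [exists p, X_ p \in W], [exists q, Y_ q \in W] &
   [forall p, forall q, (X_ p \in W) && (Y_ q \in W) ==> (p < q)%N && e p q]].

(** An ordering of W that begins with an x-vertex and a y-vertex. It names one coordinate of a
    cycle: the word [s] with the monomial x_p y_q. *)
Definition arrangement (W : {set V}) (p q : 'I_n) (s : seq V) : Prop :=
  uniq [:: X_ p, Y_ q & s] /\ W = [set x in [:: X_ p, Y_ q & s]].

Lemma arrangement_exists e k W : bicomplete e k W -> exists p q s, arrangement W p q s.
Proof.
case/and4P=> _ /existsP[p pW] /existsP[q qW] _.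
exists p, q, (enum (W :\ X_ p :\ Y_ q)); split.
  by rewrite /= enum_uniq !inE !mem_enum !inE !eqxx XY_neq !andbF.
by apply/setP=> x; rewrite !inE mem_enum !inE; case: eqP => [->|] //=; case: eqP => [->|].
Qed.

Lemma arrangement_size e i W p q s : bicomplete e i.+2 W -> arrangement W p q s -> size s = i.
Proof.
move=> /andP[/eqP Wi _] [us W_eq]; move: Wi; rewrite W_eq cardsE.
by rewrite (card_uniqP us) => -[].
Qed.

Context {K : fieldType}.
Local Notation S := {mpoly K[n + n]}.

(* Every monomial of a quadric of [I] is below an edge monomial of that quadric;
   on quadrics the order of mpoly agrees with [lex_lt]. *)
Definition led_by_edges (e : rel 'I_n) (I : S -> Prop) : Prop :=
  forall f u, I f -> f \is 2.-homog -> u \in msupp f ->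
  exists p q : 'I_n, [/\ (p < q)%N, e p q, XY p q \in msupp f & (u <= XY p q)%O].

(** * The component of largest multidegree of a cycle *)

Section Top.
Context {e : rel 'I_n} {I : S -> Prop} {i : nat} {t : seq V -> S}.
Hypothesis I_led : led_by_edges e I.
Hypothesis t_cycle : linear_cycle I i t.

Definition multidegree (s : seq V) (u : 'X_{1..n + n}) : 'X_{1..n + n} :=
  ((\big[+%MM/0%MM]_(x <- s) U_(x)) + u)%MM.

Lemma perm_multidegree s s' u : perm_eq s s' -> multidegree s u = multidegree s' u.
Proof. by move=> ss'; rewrite /multidegree (perm_big s' ss'). Qed.

Lemma multidegree_rcons s v u : multidegree (rcons s v) u = multidegree s (U_(v) + u)%MM.
Proof. by rewrite /multidegree -cats1 big_cat big_seq1 /= addmA. Qed.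

Context {d : 'X_{1..n + n}}.
Hypothesis d_top : forall s u, size s = i -> u \in msupp (t s) -> (multidegree s u <= d)%O.

(* [d] is the largest multidegree in which [t] is nonzero; a top place is a
   nonzero coordinate of the component of [t] of multidegree [d]. *)
Definition top_place s p q : Prop :=
  [/\ size s = i, multidegree s (XY p q) = d & XY p q \in msupp (t s)].

(** The edge monomial above [u] occurs at the same word, so maximality of [d] leaves no room between
    the two. *)
Lemma top_place_of s u : size s = i -> multidegree s u = d -> u \in msupp (t s) ->
  exists p q, [/\ u = XY p q, top_place s p q & (p < q)%N && e p q].
Proof.
move=> si sud us.
have [p [q [pq epq pqs u_le]]] := I_led (cycle_in_ideal t_cycle si) (cycle_homog t_cycle si) us.
suff u_eq : u = XY p q.
  by exists p, q; rewrite pq epq; split=> //; split; rewrite -?u_eq.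
apply/eqP; rewrite eq_le u_le /=; have := d_top si pqs.
by rewrite -sud /multidegree lemc_add2r.
Qed.

Lemma top_place_edge s p q : top_place s p q -> (p < q)%N && e p q.
Proof.
case=> si sd /(top_place_of si sd)[p' [q' [E _ edge]]].
by have [-> ->] := XY_inj E.
Qed.

Lemma top_place_swap p q s1 u v s2 :
  top_place (s1 ++ u :: v :: s2) p q -> top_place (s1 ++ v :: u :: s2) p q.
Proof.
have uv : perm_eq (s1 ++ u :: v :: s2) (s1 ++ v :: u :: s2).
  by rewrite perm_cat2l -[u :: _]/([:: u] ++ [:: v] ++ s2) perm_catCA.
move=> [si sd]; rewrite (cycle_swap t_cycle si) (perm_mem (msuppN _)) => pqs.
by split; rewrite // -?(perm_size uv) // -(perm_multidegree _ uv).
Qed.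

Lemma top_place_perm p q s s' : perm_eq s s' -> top_place s p q -> top_place s' p q.
Proof.
by apply: (perm_swap_closed (P := fun s => top_place s p q)) => *; apply: top_place_swap.
Qed.

Lemma top_place_uniq_tail p q s : top_place s p q -> uniq s.
Proof.
apply: contraPT => /not_uniq_perm[x [s' ss']] /(top_place_perm ss')[si _].
by rewrite (cycle_repeat (s1 := [::]) t_cycle si) msupp0.
Qed.

(* Among the terms of the closedness relation in the multidegree of v x_p y_q,
   another one besides the given one must be nonzero. *)
Lemma top_place_exchange p q s v : top_place (rcons s v) p q ->
  (exists p', [/\ v = X_ p', p' != p & top_place (rcons s (X_ p)) p' q]) \/
  (exists q', [/\ v = Y_ q', q' != q & top_place (rcons s (Y_ q)) p q']).
Proof.
move=> [si sd pqs]; rewrite size_rcons in si.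
pose M := (U_(v) + XY p q)%MM.
have coefM w : ('X_w * t (rcons s w))@_M =
    if (U_(w) <= M)%MM then (t (rcons s w))@_(M - U_(w)) else 0.
  rewrite mulrC; case: ifPn => [wM|wM]; first by rewrite -{1}(submK wM) addmC mcoeffMX.
  apply: memN_msupp_eq0; apply: contra wM; rewrite (perm_mem (msuppMX _ _)).
  by case/mapP=> m' _ ->; apply: lem_addr.
have [w wv wnz] : exists2 w, w != v & ('X_w * t (rcons s w))@_M != 0.
  apply/exists_inP; apply: contraLR pqs; rewrite negb_exists_in => /forall_inP z.
  have /(congr1 (mcoeff M)) := cycle_closed t_cycle si.
  rewrite raddf_sum mcoeff0 (bigD1 v) //= big1 ?addr0 => [|w /z]; last by rewrite negbK => /eqP.
  by rewrite coefM lem_addr /M [X in (X - _)%MM]addmC addmK => /eqP; rewrite mcoeff_eq0.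
move: wnz; rewrite coefM; case: ifP => [wM|_]; last by rewrite eqxx.
rewrite -mcoeff_msupp => ws.
have wsz : size (rcons s w) = i by rewrite size_rcons.
have wsd : multidegree (rcons s w) (M - U_(w)) = d.
  by rewrite multidegree_rcons addmC submK // -sd multidegree_rcons.
have [p' [q' [wE w_top _]]] := top_place_of wsz wsd ws.
have ME : (U_(w) + XY p' q')%MM = M by rewrite -wE addmC submK.
(* The variable [w] divides v x_p y_q and differs from [v], so it is x_p or y_q; cancelling it
   determines the new place. *)
have := lep1mP w M; rewrite wM => /esym.
rewrite !mnmDE !mnm1E (eq_sym v) (negPf wv) add0n addn_eq0 negb_and !eqb0 !negbK.
case/orP=> /eqP weq; rewrite -weq in wv w_top ME * => {w weq wM ws wsz wsd wE}; move: ME.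
  have -> : M = (U_(X_ p) + (U_(v) + U_(Y_ q)))%MM.
    by rewrite /M /XY !addmA [(U_(v) + _)%MM]addmC.
  move/addmI/eqP; rewrite mnm1D_eq XY_neq /= orbF => /andP[/eqP vp /eqP/Y_inj qq].
  left; exists p'; split; [by []| |by rewrite -qq].
  by apply: contra wv => /eqP<-; rewrite vp.
have -> : M = (U_(Y_ q) + (U_(v) + U_(X_ p)))%MM by rewrite /M /XY addmA addmC.
move/addmI/eqP; rewrite mnm1D_eq YX_neq andbF /= => /andP[/eqP/X_inj pp /eqP vq].
right; exists q'; split; [by []| |by rewrite -pp].
by apply: contra wv => /eqP<-; rewrite vq.
Qed.

(** If x_p or y_q occurred in [s], it could be moved last, and the exchange would replace it by a
    vertex of its side different from itself. *)
Lemma top_place_uniq p q s : top_place s p q -> uniq [:: X_ p, Y_ q & s].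
Proof.
move=> ts; rewrite /= !inE XY_neq /= (top_place_uniq_tail ts) andbT.
have move_last x : x \in s -> perm_eq s (rcons (rem x s) x).
  by move=> xs; rewrite -cats1 perm_sym perm_catC perm_sym perm_to_rem.
apply/andP; split; apply/negP=> /move_last/top_place_perm/(_ ts).
  by case/top_place_exchange=> [[p' [/X_inj->]]|[q' [/eqP]]]; rewrite ?eqxx ?XY_neq.
by case/top_place_exchange=> [[p' [/eqP]]|[q' [/Y_inj->]]]; rewrite ?eqxx ?YX_neq.
Qed.

(** Any x-vertex of the word can take the place of p: move it last and exchange. *)
Lemma top_place_move_X p q s a : top_place s p q -> X_ a \in [:: X_ p, Y_ q & s] ->
  exists2 s', top_place s' a q & perm_eq [:: X_ p, Y_ q & s] [:: X_ a, Y_ q & s'].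
Proof.
move=> ts; rewrite !inE XY_neq /= => /predU1P[/X_inj->|as_]; first by exists s.
have ss : perm_eq s (rcons (rem (X_ a) s) (X_ a)).
  by rewrite -cats1 perm_sym perm_catC perm_sym perm_to_rem.
have [[p' [/X_inj<- _ ts']]|[q' [/eqP]]] := top_place_exchange (top_place_perm ss ts); last first.
  by rewrite XY_neq.
exists (rcons (rem (X_ a) s) (X_ p)) => //.
move: ss; rewrite -(perm_cons (Y_ q)) -(perm_cons (X_ p)) => /perm_trans; apply.
by apply/seq.permP=> f; rewrite /= -!cats1 !count_cat /=; lia.
Qed.

Lemma top_place_move_Y p q s b : top_place s p q -> Y_ b \in [:: X_ p, Y_ q & s] ->
  exists2 s', top_place s' p b & perm_eq [:: X_ p, Y_ q & s] [:: X_ p, Y_ b & s'].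
Proof.
move=> ts; rewrite !inE YX_neq /= => /predU1P[/Y_inj->|bs_]; first by exists s.
have ss : perm_eq s (rcons (rem (Y_ b) s) (Y_ b)).
  by rewrite -cats1 perm_sym perm_catC perm_sym perm_to_rem.
case: (top_place_exchange (top_place_perm ss ts)) => [[p' [/eqP]]|[q' [/Y_inj<- _ ts']]].
  by rewrite YX_neq.
exists (rcons (rem (Y_ b) s) (Y_ q)) => //.
move: ss; rewrite -(perm_cons (Y_ q)) -(perm_cons (X_ p)) => /perm_trans; apply.
by apply/seq.permP=> f; rewrite /= -!cats1 !count_cat /=; lia.
Qed.

(** Any x-vertex and any y-vertex of the set can be moved into the monomial, which is always an
    edge. *)
Lemma top_place_bicomplete p q s : top_place s p q ->
  bicomplete e i.+2 [set x in [:: X_ p, Y_ q & s]].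
Proof.
move=> ts; apply/and4P; split.
- rewrite cardsE (card_uniqP (top_place_uniq ts)) /=; by case: ts => ->.
- by apply/existsP; exists p; rewrite !inE eqxx.
- by apply/existsP; exists q; rewrite !inE eqxx orbT.
apply/forallP=> a; apply/forallP=> b; apply/implyP; rewrite !inE -!in_cons => /andP[aW bW].
have [s1 ts1 ss1] := top_place_move_X ts aW.
have [|s2 ts2 _] := top_place_move_Y ts1 (b := b); first by rewrite -(perm_mem ss1).
exact: top_place_edge ts2.
Qed.

Lemma top_place_arrangement p q s p' q' s' : top_place s p q ->
  arrangement [set x in [:: X_ p, Y_ q & s]] p' q' s' -> top_place s' p' q'.
Proof.
move=> ts [us' W_eq].
have ss : perm_eq [:: X_ p, Y_ q & s] [:: X_ p', Y_ q' & s'].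
  apply: uniq_perm => [||x]; [exact: top_place_uniq ts|by []|].
  by have /setP/(_ x) := W_eq; rewrite !inE.
have pW : X_ p' \in [:: X_ p, Y_ q & s] by rewrite (perm_mem ss) mem_head.
have [s1 ts1 ss1] := top_place_move_X ts pW.
have qW : Y_ q' \in [:: X_ p', Y_ q & s1].
  by rewrite -(perm_mem ss1) (perm_mem ss) !inE eqxx orbT.
have [s2 ts2 ss2] := top_place_move_Y ts1 qW.
apply: top_place_perm ts2; rewrite -(perm_cons (Y_ q')) -(perm_cons (X_ p')).
by rewrite perm_sym in ss; rewrite perm_sym; apply: perm_trans ss (perm_trans ss1 ss2).
Qed.

End Top.

(** A nonzero cycle has a top place; its vertices form a bicomplete set, and the coordinate chosen
    for that set is again a top place, hence nonzero. *)
Lemma cycle_eq0_of_coordinates e I i t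
    (place : {W : {set V} | bicomplete e i.+2 W} -> 'I_n * 'I_n * seq V) :
  led_by_edges e I -> linear_cycle I i t ->
  (forall W, arrangement (val W) (place W).1.1 (place W).1.2 (place W).2) ->
  (forall W, (t (place W).2)@_(XY (place W).1.1 (place W).1.2) = 0) ->
  forall s, size s = i -> t s = 0.
Proof.
move=> I_led t_cycle placeP t0 s si; apply/eqP/negPn/negP=> ts0.
have [u us] : exists u, u \in msupp (t s).
  by move: ts0; rewrite -msupp_eq0; case: msupp => [//|u l _]; exists u; apply: mem_head.
(* Monomials that occur have degree 2, so the places form a finite type and a largest multidegree
   exists. The bound of [bmultinom] is strict, hence 3. *)
have u3 s' u' : size s' = i -> u' \in msupp (t s') -> (mdeg u' < 3)%N.
  by move=> s'i u's; have /dhomogP/(_ _ u's) /= -> := cycle_homog t_cycle s'i.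
pose nz (x : i.-tuple V * bmultinom (n + n) 3) := val x.2 \in msupp (t x.1).
have nz0 : nz (Tuple (introT eqP si), BMultinom (u3 _ _ si us)) by [].
pose wt (x : i.-tuple V * bmultinom (n + n) 3) := multidegree x.1 (val x.2).
case: (Order.TotalTheory.arg_maxP wt nz0) => -[s1 u1] nz1 top1.
have d_top s' u' : size s' = i -> u' \in msupp (t s') -> (multidegree s' u' <= wt (s1, u1))%O.
  move=> s'i u's; exact: (top1 (Tuple (introT eqP s'i), BMultinom (u3 _ _ s'i u's))).
have [p [q [_ ts1 _]]] := top_place_of I_led t_cycle d_top (size_tuple s1) erefl nz1.
have bW := top_place_bicomplete I_led t_cycle d_top ts1.
pose W := exist (fun W => is_true (bicomplete e i.+2 W)) _ bW.
have [_ _] := top_place_arrangement I_led t_cycle d_top ts1 (placeP W).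
by rewrite mcoeff_msupp t0 eqxx.
Qed.

End Bipartite.

(** * A cycle for each complete bipartite subgraph *)

Section WordSign.
Context {R : comNzRingType} {T : eqType}.
Variables (x0 : T) (z : seq T).

Definition word_mx (w : seq T) : 'M[R]_(size z) :=
  \matrix_(a, b) (nth x0 w a == nth x0 z b)%:R.

(* The sign of [w] as a rearrangement of [z], and [0] when it is not one. *)
Definition word_sign (w : seq T) : R := \det (word_mx w).

Lemma nth_exchange (w1 w2 w3 : seq T) u v a :
  nth x0 (w1 ++ u :: w2 ++ v :: w3) a =
  nth x0 (w1 ++ v :: w2 ++ u :: w3)
    (if a == size w1 then (size w1 + size w2).+1
     else if a == (size w1 + size w2).+1 then size w1 else a).
Proof.
have [->|a1] := eqVneq a (size w1).
  rewrite !nth_cat ltnn subnn ltnNge ltnW ?ltnS ?leq_addr //=.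
  by rewrite -addnS addKn /= nth_cat ltnn subnn.
have [->|a2] := eqVneq a (size w1 + size w2).+1.
  rewrite !nth_cat ltnn subnn [in LHS]ltnNge ltnW ?ltnS ?leq_addr //=.
  by rewrite -addnS addKn /= nth_cat ltnn subnn.
rewrite !nth_cat; case: ltnP => // aw1.
case E: (a - size w1)%N => [|b]; first by lia.
rewrite /= !nth_cat; case: ltnP => // bw2.
by case E': (b - size w2)%N => [|c] //; lia.
Qed.

Lemma word_sign_exchange w1 u w2 v w3 : size (w1 ++ u :: w2 ++ v :: w3) = size z ->
  word_sign (w1 ++ u :: w2 ++ v :: w3) = - word_sign (w1 ++ v :: w2 ++ u :: w3).
Proof.
rewrite size_cat /= size_cat /= => sz.
have a_lt : (size w1 < size z)%N by lia.
have b_lt : ((size w1 + size w2).+1 < size z)%N by lia.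
pose a := Ordinal a_lt; pose b := Ordinal b_lt.
have ab : a != b by rewrite -val_eqE /=; lia.
have -> : word_sign (w1 ++ u :: w2 ++ v :: w3) =
    \det (xrow a b (word_mx (w1 ++ v :: w2 ++ u :: w3))).
  congr (\det _); apply/matrixP=> c d; rewrite !mxE nth_exchange.
  congr ((nth _ _ _ == _)%:R).
  case: tpermP => [->|->|/eqP ca /eqP cb]; rewrite /= ?eqxx //.
    by rewrite gtn_eqF //=; lia.
  by move: ca cb; rewrite -!val_eqE /= => /negPf-> /negPf->.
by rewrite xrowE det_mulmx det_perm odd_tperm ab expr1 mulN1r.
Qed.

Lemma word_sign_repeat w1 u w2 w3 : size (w1 ++ u :: w2 ++ u :: w3) = size z ->
  word_sign (w1 ++ u :: w2 ++ u :: w3) = 0.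
Proof.
rewrite size_cat /= size_cat /= => sz.
have a_lt : (size w1 < size z)%N by lia.
have b_lt : ((size w1 + size w2).+1 < size z)%N by lia.
have ab : Ordinal a_lt != Ordinal b_lt by rewrite -val_eqE /=; lia.
apply: (determinant_alternate ab) => c; rewrite !mxE nth_exchange /=.
by rewrite eqxx.
Qed.

(** A letter of [w] outside [z] gives a zero row of the matrix. *)
Lemma word_sign_sub w : size w = size z -> word_sign w != 0 -> {subset w <= z}.
Proof.
move=> wz nz x xw; apply: contraNT nz => xz; apply/eqP.
have x_lt : (index x w < size z)%N by rewrite -wz index_mem.
rewrite /word_sign (expand_det_row _ (Ordinal x_lt)) big1 // => b _.
rewrite mxE /= nth_index //; case: eqP => [xb|]; last by rewrite mul0r.
by rewrite xb mem_nth in xz.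
Qed.

Lemma word_sign_self : uniq z -> word_sign z = 1.
Proof.
move=> uz; rewrite /word_sign (_ : word_mx z = 1%:M) ?det1 //.
by apply/matrixP=> a b; rewrite !mxE nth_uniq.
Qed.

End WordSign.

Section IdealGen.
Context {m : nat} {K : fieldType}.
Local Notation S := {mpoly K[m]}.

Lemma mem_ideal_gen (P : S -> Prop) g : P g -> ideal_gen P g.
Proof.
by move=> Pg; exists 1%N, (fun=> 1), (fun=> g); split=> //; rewrite big_ord1 mul1r.
Qed.

Lemma ideal_gen0 (P : S -> Prop) : ideal_gen P 0.
Proof. by exists 0%N, (fun=> 0), (fun=> 0); split; [case|rewrite big_ord0]. Qed.

Lemma ideal_genMD (P : S -> Prop) a f g :
  ideal_gen P f -> ideal_gen P g -> ideal_gen P (a * f + g).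
Proof.
move=> [k [c [u [Pu ->]]]] [l [d [v [Pv ->]]]].
exists (k + l)%N, (fun j => match split j with inl j => a * c j | inr j => d j end),
  (fun j => match split j with inl j => u j | inr j => v j end).
split=> [j|]; first by case: split => ?.
rewrite big_split_ord mulr_sumr /=; congr (_ + _); apply: eq_bigr => j _.
  by rewrite (unsplitK (inl _ j)) mulrA.
by rewrite (unsplitK (inr _ j)).
Qed.

Lemma ideal_genM (P : S -> Prop) a f : ideal_gen P f -> ideal_gen P (a * f).
Proof. by move=> Pf; rewrite -[_ * _]addr0; apply: ideal_genMD (ideal_gen0 _). Qed.

Lemma ideal_gen_sum (P : S -> Prop) (J : finType) (Q : pred J) F :
  (forall j, Q j -> ideal_gen P (F j)) -> ideal_gen P (\sum_(j | Q j) F j).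
Proof.
move=> PF; elim/big_rec: _ => [|j f Qj Pf]; first exact: ideal_gen0.
by rewrite -[F j]mul1r; apply: ideal_genMD (PF j Qj) Pf.
Qed.

Lemma ideal_gen_sub (P Q : S -> Prop) : (forall g, P g -> ideal_gen Q g) ->
  forall f, ideal_gen P f -> ideal_gen Q f.
Proof.
move=> PQ f [k [c [g [Pg ->]]]]; apply: ideal_gen_sum => j _.
by apply/ideal_genM/PQ.
Qed.

End IdealGen.

(** * The signed cycle of a bicomplete set *)

Section MonomialCycles.
Context {n : nat} {K : fieldType} (e : rel 'I_n) (i : nat).
Local Notation V := 'I_(n + n).
Local Notation S := {mpoly K[n + n]}.

Lemma edge_monomial_mem (p q : 'I_n) : (p < q)%N -> e p q ->
  edge_ideal K (initial_graph e) 'X_[XY p q].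
Proof.
move=> pq epq; apply: mem_ideal_gen; exists (X_ p), (Y_ q).
rewrite mpolyXD; split=> //; rewrite /initial_graph.
by rewrite (unsplitK (inl _ p)) (unsplitK (inr _ q)) pq.
Qed.

Context {W : {set V}} {p0 q0 : 'I_n} {s0 : seq V}.
Hypotheses (W_bic : bicomplete e i.+2 W) (W_arr : arrangement W p0 q0 s0).

Definition bicomplete_sign (p q : 'I_n) (s : seq V) : K :=
  word_sign (X_ p0) [:: X_ p0, Y_ q0 & s0] [:: X_ p, Y_ q & s].

Definition bicomplete_cycle (s : seq V) : S :=
  \sum_(p : 'I_n) \sum_(q : 'I_n | (p < q)%N && e p q) bicomplete_sign p q s *: 'X_[XY p q].

Lemma bicomplete_sign_sub p q s : size s = i -> bicomplete_sign p q s != 0 ->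
  {subset [:: X_ p, Y_ q & s] <= W}.
Proof.
move=> si /word_sign_sub sub x xw; have [_ ->] := W_arr; rewrite inE sub //=.
by rewrite si (arrangement_size W_bic W_arr).
Qed.

(** The definition sums over edges only, so that the values visibly lie in the edge ideal. Non-edges
    may be added: a nonzero sign puts x_p and y_q in [W], where they are joined. *)
Lemma bicomplete_cycleE s : size s = i ->
  bicomplete_cycle s = \sum_p \sum_q bicomplete_sign p q s *: 'X_[XY p q].
Proof.
move=> si; apply: eq_bigr => p _; rewrite big_mkcond; apply: eq_bigr => q _.
case: ifPn => // pq; have [->|nz] := eqVneq (bicomplete_sign p q s) 0; first by rewrite scale0r.
case/and4P: W_bic => _ _ _ /forallP/(_ p)/forallP/(_ q)/implyP.
by rewrite !(bicomplete_sign_sub si nz) ?inE ?eqxx ?orbT // => /(_ isT); rewrite (negPf pq).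
Qed.

Lemma size_arrangement_word (s : seq V) : size s = i -> size [:: X_ p0, Y_ q0 & s0] = (size s).+2.
Proof. by move=> si; rewrite /= (arrangement_size W_bic W_arr) si. Qed.

Lemma bicomplete_cycle_linear :
  linear_cycle (edge_ideal K (initial_graph e)) i bicomplete_cycle.
Proof.
split=> [s si|s si|s1 u v s2 si|s1 u s2 si|s si].
- apply: ideal_gen_sum => p _; apply: ideal_gen_sum => q /andP[pq epq].
  by rewrite -mul_mpolyC; apply/ideal_genM/edge_monomial_mem.
- apply: rpred_sum => p _; apply: rpred_sum => q _.
  by rewrite dhomogZ // dhomogX /= mdegD !mdeg1.
- rewrite -sumrN; apply: eq_bigr => p _; rewrite -sumrN; apply: eq_bigr => q _.
  rewrite -scaleNr; congr (_ *: _).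
  by apply: (word_sign_exchange _ (w1 := [:: X_ p, Y_ q & s1]) (w2 := [::])); rewrite (size_arrangement_word si).
- apply: big1 => p _; apply: big1 => q _; rewrite [X in X *: _]/bicomplete_sign.
  rewrite (word_sign_repeat _ (w1 := [:: X_ p, Y_ q & s1]) (w2 := [::])) ?scale0r //.
  by rewrite (size_arrangement_word si).
have siv v : size (rcons s v) = i by rewrite size_rcons.
have term v : 'X_v * bicomplete_cycle (rcons s v) =
    \sum_p \sum_q bicomplete_sign p q (rcons s v) *: 'X_[U_(v) + XY p q].
  rewrite bicomplete_cycleE // mulr_sumr; apply: eq_bigr => p _.
  by rewrite mulr_sumr; apply: eq_bigr => q _; rewrite -scalerAr mpolyXD.
under eq_bigr do rewrite term.
(* The multiplying variable is some x_a or some y_b. Exchanging it with x_p, respectively y_q, keeps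
   the monomial and flips the sign, so each of the two sums cancels. *)
rewrite big_split_ord /= [X in X + _](_ : _ = 0) ?add0r; last first.
  apply: alternating_sum_eq0 => [a p|a].
    rewrite -sumrN; apply: eq_bigr => q _; rewrite -scaleNr.
    congr (_ *: 'X_[_]); last by rewrite /XY !addmA [(U_(lshift n a) + _)%MM]addmC.
    rewrite /bicomplete_sign -!cats1.
    apply: (word_sign_exchange _ (w1 := [::]) (w2 := Y_ q :: s)).
    by rewrite (size_arrangement_word (siv (X_ p0))) size_rcons /= size_cat addn1.
  apply: big1 => q _; rewrite /bicomplete_sign -cats1.
  rewrite (word_sign_repeat _ (w1 := [::]) (w2 := Y_ q :: s)) ?scale0r //.
  by rewrite (size_arrangement_word (siv (X_ p0))) size_rcons /= size_cat addn1.
rewrite exchange_big big1 //= => p _; apply: alternating_sum_eq0 => [b q|b].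
  rewrite -scaleNr; congr (_ *: 'X_[_]).
    rewrite /bicomplete_sign -!cats1.
    apply: (word_sign_exchange _ (w1 := [:: X_ p]) (w2 := s)).
    by rewrite (size_arrangement_word (siv (X_ p0))) size_rcons /= size_cat addn1.
  by rewrite /XY addmA addmC [(U_(rshift n b) + _)%MM]addmC.
rewrite /bicomplete_sign -cats1.
rewrite (word_sign_repeat _ (w1 := [:: X_ p]) (w2 := s)) ?scale0r //.
by rewrite (size_arrangement_word (siv (X_ p0))) size_rcons /= size_cat addn1.
Qed.

Lemma coef_bicomplete_cycle s (p q : 'I_n) : size s = i ->
  (bicomplete_cycle s)@_(XY p q) = bicomplete_sign p q s.
Proof.
move=> si; rewrite bicomplete_cycleE // raddf_sum (bigD1 p) //= raddf_sum (bigD1 q) //=.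
rewrite mcoeffZ mcoeffX eqxx mulr1 big1 ?addr0 => [|q' q'q]; last first.
  by rewrite mcoeffZ mcoeffX; case: eqP => [/XY_inj[_ E]|]; rewrite ?mulr0 // E eqxx in q'q *.
rewrite big1 ?addr0 // => p' p'p; rewrite raddf_sum big1 //= => q' _.
by rewrite mcoeffZ mcoeffX; case: eqP => [/XY_inj[E _]|]; rewrite ?mulr0 // E eqxx in p'p *.
Qed.

Lemma bicomplete_sign_self : bicomplete_sign p0 q0 s0 = 1.
Proof. by apply: word_sign_self; have [] := W_arr. Qed.

Lemma bicomplete_sign_other W' p q s :
  bicomplete e i.+2 W' -> arrangement W' p q s -> W != W' -> bicomplete_sign p q s = 0.
Proof.
move=> W'_bic W'_arr; apply: contraNeq => nz; rewrite eq_sym eqEcard.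
have /andP[/eqP-> _] := W_bic; have /andP[/eqP-> _] := W'_bic; rewrite leqnn andbT.
apply/subsetP=> x; have [_ ->] := W'_arr; rewrite inE => xs.
exact: (bicomplete_sign_sub (arrangement_size W'_bic W'_arr) nz).
Qed.

End MonomialCycles.

(** * The initial ideal of a closed graph *)

Section QuadricIdeals.
Context {m : nat} {K : fieldType} {P : {mpoly K[m]} -> Prop}.
Local Notation S := {mpoly K[m]}.
Hypothesis P_quad : forall g, P g -> g \is 2.-homog.

Lemma quadric_ideal_homogeneous : homogeneous_ideal (ideal_gen P).
Proof.
split=> [|a f g|d f [k [c [g [Pg ->]]]]]; [exact: ideal_gen0|exact: ideal_genMD|].
rewrite raddf_sum; apply: ideal_gen_sum => j _ /=.
rewrite (pihomogM_homog _ _ (P_quad (Pg j))); case: ifP => _; last exact: ideal_gen0.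
by apply: ideal_genM; apply: mem_ideal_gen.
Qed.

Lemma quadric_ideal_low f u : ideal_gen P f -> (mdeg u < 2)%N -> f@_u = 0.
Proof.
move=> [k [c [g [Pg ->]]]] u2; rewrite raddf_sum big1 // => j _ /=.
have := pihomogM_homog (mdeg u) (c j) (P_quad (Pg j)); rewrite leqNgt u2 /=.
by move/(congr1 (mcoeff u)); rewrite mcoeff_pihomog eqxx mcoeff0.
Qed.

(** Comparing components of degree 2, only the constant terms of the multipliers survive. *)
Lemma quadric_ideal_degree2 f : ideal_gen P f -> f \is 2.-homog ->
  exists k (a : 'I_k -> K) g, (forall j, P (g j)) /\ f = \sum_j a j *: g j.
Proof.
move=> [k [c [g [Pg fE]]]] f2; exists k, (fun j => (c j)@_0%MM), g; split=> //.
rewrite -(pihomog_dE f2) fE raddf_sum; apply: eq_bigr => j _ /=.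
rewrite (pihomogM_homog _ _ (P_quad (Pg j))) /= subnn.
have := shifted_component_coef0 0 (c j); rewrite /shifted_component /= => ->.
by rewrite mul_mpolyC.
Qed.

End QuadricIdeals.

Section LexOrder.
Context {m : nat}.
Implicit Types u v : 'X_{1..m}.

(** The degree-first order of mpoly breaks ties lexicographically. *)
Lemma lex_ltE u v : mdeg u = mdeg v -> lex_lt u v = (u < v)%O.
Proof.
move=> uv; apply/existsP/(ltmcP uv) => [[k /andP[/forallP lt_k uvk]]|[k lt_k uvk]].
  by exists k => // l lk; apply/eqP; have /implyP/(_ lk) := lt_k l.
by exists k; rewrite uvk andbT; apply/forallP=> l; apply/implyP=> /lt_k->.
Qed.

End LexOrder.

(** * Leading monomials of the binomial edge ideal *)

Section BinomialEdgeIdeal.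
Context {n : nat} {K : fieldType}.
Local Notation S := {mpoly K[n + n]}.

Lemma edge_binomialE (i j : 'I_n) : edge_binomial K i j = 'X_[XY i j] - 'X_[XY j i].
Proof. by rewrite /edge_binomial !mpolyXD. Qed.

Lemma XY_lt (p q : 'I_n) : (p < q)%N -> (XY q p < XY p q)%O.
Proof.
move=> pq; have pq' : (p == q) = false by apply/eqP=> pq'; rewrite pq' ltnn in pq.
apply/ltmcP; first by rewrite !mdegD !mdeg1.
exists (X_ p) => [j jp|]; rewrite !mnmDE !mnm1E.
  have jn : (j < n)%N by apply: ltn_trans jp _; rewrite /= ltn_ord.
  rewrite !(eq_sym _ j) -!val_eqE /= in jp *.
  by rewrite !ltn_eqF ?(ltn_trans jp pq) // (leq_trans jn) ?leq_addr.
by rewrite !(inj_eq X_inj) eqxx YX_neq (eq_sym q) pq' YX_neq.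
Qed.

Lemma edge_binomial_homog (i j : 'I_n) : edge_binomial K i j \is 2.-homog.
Proof.
by rewrite edge_binomialE rpredB // dhomogX /= mdegD !mdeg1.
Qed.

Lemma coef_edge_binomial (i j a b : 'I_n) :
  (edge_binomial K i j)@_(XY a b) = - (edge_binomial K i j)@_(XY b a).
Proof.
have XYE p q x y : (XY p q == XY x y) = (p == x) && (q == y).
  apply/eqP/andP=> [/XY_inj[-> ->]|[/eqP-> /eqP->]] //; by rewrite !eqxx.
rewrite edge_binomialE !mcoeffB !mcoeffX opprB !XYE.
by rewrite [(j == b) && _]andbC [(i == b) && _]andbC.
Qed.

Lemma msupp_edge_binomial (i j : 'I_n) u : u \in msupp (edge_binomial K i j) ->
  u = XY i j \/ u = XY j i.
Proof.
rewrite edge_binomialE => /msuppB_le; rewrite mem_cat !msuppX !inE.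
by case/orP=> /eqP; [left|right].
Qed.

Lemma edge_binomial_lead m (a b : 'I_n) : (a < b)%N ->
  is_lead_monom ('X_[m] * edge_binomial K a b) (m + XY a b).
Proof.
move=> ab; have ba := XY_lt ab.
have mE u : u \in msupp ('X_[m] * edge_binomial K a b) -> exists2 v,
    u = (m + v)%MM & v \in msupp (edge_binomial K a b).
  by rewrite mulrC (perm_mem (msuppMX _ _)) => /mapP[v vs ->]; exists v.
split=> [|u /mE[v -> /msupp_edge_binomial[->|->]]]; last 2 first.
- by rewrite eqxx.
- by move=> _; rewrite lex_ltE ?mdegD ?mdeg1 // ltmc_add2r.
rewrite mcoeff_msupp mulrC mcoeffMX edge_binomialE mcoeffB !mcoeffX eqxx.
by rewrite (lt_eqF ba) subr0 oner_eq0.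
Qed.

Context {e : rel 'I_n}.
Let J := binomial_edge_ideal K e.
Let in_graph_ideal := edge_ideal K (initial_graph e).

Lemma binomial_edge_quadric (g : S) : (exists i j : 'I_n,
    [/\ (i < j)%N, e i j & g = edge_binomial K i j]) -> g \is 2.-homog.
Proof. by case=> i [j [_ _ ->]]; apply: edge_binomial_homog. Qed.

Lemma initial_graph_edge u v : initial_graph e u v ->
  exists p q : 'I_n, [/\ (p < q)%N, e p q & (U_(u) + U_(v))%MM = XY p q].
Proof.
have := splitK v; have := splitK u; rewrite /initial_graph.
case: (split u) => p <-; case: (split v) => q <- //= /andP[pq epq].
  by exists p, q.
by exists q, p; rewrite addmC.
Qed.

Lemma edge_ideal_quadric (g : S) : (exists u v, initial_graph e u v /\ g = 'X_u * 'X_v) ->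
  g \is 2.-homog.
Proof. by case=> u [v [_ ->]]; rewrite -mpolyXD dhomogX /= mdegD !mdeg1. Qed.

(** Quadrics of J are antisymmetric under exchange of x_a y_b with x_b y_a, so x_q y_p never occurs
    without the larger x_p y_q. *)
Lemma binomial_edge_ideal_led : led_by_edges e J.
Proof.
move=> f u Jf f2 uf.
have [k [a [g [gP fE]]]] := quadric_ideal_degree2 binomial_edge_quadric Jf f2.
have f_swap x y : f@_(XY x y) = - f@_(XY y x).
  rewrite fE !raddf_sum; apply: eq_bigr => j _ /=; rewrite !mcoeffZ -mulrN.
  by have [p [q [_ _ ->]]] := gP j; rewrite coef_edge_binomial.
have [j uj] : exists j, u \in msupp (g j).
  apply/existsP; apply: contraLR uf; rewrite negb_exists => /forallP ug.
  rewrite -mcoeff_eq0 fE raddf_sum big1 // => j _ /=.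
  by rewrite mcoeffZ (memN_msupp_eq0 (ug j)) mulr0.
have [p [q [pq epq gE]]] := gP j; exists p, q.
move: uj; rewrite gE => /msupp_edge_binomial[uE|uE]; first by rewrite -uE.
split=> //; last by rewrite uE ltW // XY_lt.
by rewrite mcoeff_msupp f_swap -uE oppr_eq0 -mcoeff_msupp.
Qed.

Lemma edge_ideal_led : led_by_edges e in_graph_ideal.
Proof.
move=> f u If f2 uf.
have [k [a [g [gP fE]]]] := quadric_ideal_degree2 edge_ideal_quadric If f2.
have [j uj] : exists j, u \in msupp (g j).
  apply/existsP; apply: contraLR uf; rewrite negb_exists => /forallP ug.
  rewrite -mcoeff_eq0 fE raddf_sum big1 // => j _ /=.
  by rewrite mcoeffZ (memN_msupp_eq0 (ug j)) mulr0.
have [x [y [/initial_graph_edge[p [q [pq epq xyE]]] gE]]] := gP j.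
by exists p, q; move: uj uf; rewrite gE -mpolyXD xyE msuppX inE => /eqP->.
Qed.

Lemma edge_ideal_monomial u : in_graph_ideal 'X_[u] ->
  exists p q : 'I_n, [/\ (p < q)%N, e p q & (XY p q <= u)%MM].
Proof.
case=> k [c [g [gP uE]]].
have [j uj] : exists j, u \in msupp (c j * g j).
  apply/existsP; have : u \in msupp ('X_[u] : S) by rewrite msuppX mem_head.
  apply: contraLR; rewrite negb_exists => /forallP ug.
  rewrite -mcoeff_eq0 uE raddf_sum big1 // => j _; exact: memN_msupp_eq0.
have [x [y [/initial_graph_edge[p [q [pq epq xyE]]] gE]]] := gP j.
move: uj; rewrite gE -mpolyXD xyE (perm_mem (msuppMX _ _)) => /mapP[v _ ->].
by exists p, q; rewrite lem_addr.
Qed.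

Lemma edge_binomial_mem (i j : 'I_n) : (i < j)%N -> e i j -> J (edge_binomial K i j).
Proof. by move=> ij eij; apply: mem_ideal_gen; exists i, j. Qed.

Hypothesis e_closed : closed_graph K e.

(** The elements of a quadratic Gröbner basis are quadrics of J, so their leading monomials are edge
    monomials; conversely each edge monomial leads its own binomial. *)
Lemma initial_ideal_closed f : initial_ideal J f <-> in_graph_ideal f.
Proof.
split; last first.
  apply: ideal_gen_sub => _ [x [y [/initial_graph_edge[p [q [pq epq xyE]]] ->]]].
  rewrite -mpolyXD xyE; apply: mem_ideal_gen; exists (edge_binomial K p q), (XY p q).
  split=> //; first exact: edge_binomial_mem.
  by have := edge_binomial_lead 0%MM pq; rewrite mpolyX0 mul1r add0m.
have [gs [gs2 [gsJ gsin]]] := e_closed.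
move/gsin; apply: ideal_gen_sub => _ [g [u [gg [ug lead_u] ->]]].
have [p [q [pq epq pqg u_le]]] := binomial_edge_ideal_led (gsJ g gg) (gs2 g gg) ug.
suff -> : u = XY p q by apply: edge_monomial_mem.
apply/eqP/negPn/negP=> u_neq; have := lead_u _ pqg; rewrite eq_sym u_neq => /(_ isT).
have g_deg w : w \in msupp g -> mdeg w = 2 by have /dhomogP := gs2 g gg; apply.
by rewrite lex_ltE ?g_deg // ltNge u_le.
Qed.

Lemma closed_lead_divides f u : J f -> is_lead_monom f u ->
  exists p q : 'I_n, [/\ (p < q)%N, e p q & (XY p q <= u)%MM].
Proof.
move=> Jf fu; apply: edge_ideal_monomial; apply/initial_ideal_closed.
by apply: mem_ideal_gen; exists f, u.
Qed.

(** The relation x_c f_ab = x_b f_ac - x_a f_bc puts x_c x_a y_b in the initial ideal. *)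
Lemma closed_upper (a b c : 'I_n) : (a < b)%N -> (b < c)%N -> e a c -> e b c -> e a b.
Proof.
move=> ab bc eac ebc; have ac := ltn_trans ab bc.
have [||p [q [pq epq /mnm_lepP pq_le]]] :=
    closed_lead_divides (f := 'X_(X_ c) * edge_binomial K a b) (u := U_(X_ c) + XY a b).
- have -> : 'X_(X_ c) * edge_binomial K a b =
      'X_(X_ b) * edge_binomial K a c + (- 'X_(X_ a)) * edge_binomial K b c.
    by rewrite /edge_binomial; ring.
  by apply: ideal_genMD; [|apply: ideal_genM]; apply: edge_binomial_mem.
- exact: edge_binomial_lead.
have := pq_le (Y_ q); have := pq_le (X_ p).
rewrite !mnmDE !mnm1E !eqxx !XY_neq !YX_neq !(inj_eq X_inj) !(inj_eq Y_inj).
(* An edge monomial dividing it is x_a y_b or x_c y_b, and the latter is excluded by b < c. *)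
case: (b =P q) => [bq|] //; case: (a =P p) => [ap|]; first by rewrite ap bq.
by case: (c =P p) => // cp; move: pq; rewrite -bq -cp ltnNge ltnW.
Qed.

(** The same argument with y_a f_bc = y_b f_ac - y_c f_ab: among the divisors of y_a x_b y_c, x_b
    y_a is excluded by a < b. *)
Lemma closed_lower (a b c : 'I_n) : (a < b)%N -> (b < c)%N -> e a b -> e a c -> e b c.
Proof.
move=> ab bc eab eac; have ac := ltn_trans ab bc.
have [||p [q [pq epq /mnm_lepP pq_le]]] :=
    closed_lead_divides (f := 'X_(Y_ a) * edge_binomial K b c) (u := U_(Y_ a) + XY b c).
- have -> : 'X_(Y_ a) * edge_binomial K b c =
      'X_(Y_ b) * edge_binomial K a c + (- 'X_(Y_ c)) * edge_binomial K a b.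
    by rewrite /edge_binomial; ring.
  by apply: ideal_genMD; [|apply: ideal_genM]; apply: edge_binomial_mem.
- exact: edge_binomial_lead.
have := pq_le (Y_ q); have := pq_le (X_ p).
rewrite !mnmDE !mnm1E !eqxx !XY_neq !YX_neq !(inj_eq X_inj) !(inj_eq Y_inj).
case: (b =P p) => [bp|] //; case: (c =P q) => [cq|]; first by rewrite bp cq.
by case: (a =P q) => // aq; move: pq; rewrite -bp -aq ltnNge ltnW.
Qed.

End BinomialEdgeIdeal.

(** * Counting and conclusion *)

Section Counting.
Local Open Scope nat_scope.
Context {n : nat} {e : rel 'I_n}.
Hypothesis e_sym : ssrbool.symmetric e.
Hypothesis e_upper : forall a b c : 'I_n, a < b -> b < c -> e a c -> e b c -> e a b.
Hypothesis e_lower : forall a b c : 'I_n, a < b -> b < c -> e a b -> e a c -> e b c.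
Local Notation V := 'I_(n + n).

Definition clique (C : {set 'I_n}) : bool :=
  [forall u in C, forall v in C, (u != v) ==> e u v].

Definition split_vertex (q c : 'I_n) : V := if c < q then X_ c else Y_ c.

(* The vertices of the clique below [x.2] become x-variables, the others
   y-variables. *)
Definition split_clique (x : {set 'I_n} * 'I_n) : {set V} := split_vertex x.2 @: x.1.

Lemma split_vertex_inj q : injective (split_vertex q).
Proof.
move=> a b; rewrite /split_vertex; case: ifP => _; case: ifP => _.
- exact: X_inj.
- by move/eqP; rewrite XY_neq.
- by move/eqP; rewrite YX_neq.
- exact: Y_inj.
Qed.

Lemma X_split_clique C q a : (X_ a \in split_clique (C, q)) = (a \in C) && (a < q).
Proof.
apply/imsetP/andP => [[c cC]|[aC aq]]; last by exists a; rewrite // /split_vertex aq.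
rewrite /split_vertex; case: ifP => [cq /X_inj->|_ /eqP] //.
by rewrite XY_neq.
Qed.

Lemma Y_split_clique C q b : (Y_ b \in split_clique (C, q)) = (b \in C) && (q <= b).
Proof.
apply/imsetP/andP => [[c cC]|[bC qb]]; last by exists b; rewrite // /split_vertex ltnNge qb.
rewrite /split_vertex; case: ltnP => [_ /eqP|qc /Y_inj->] //.
by rewrite YX_neq.
Qed.

(** The vertex [x.2] opens the y-part; it may be any vertex of the clique but the smallest, so that
    both parts are nonempty. *)
Definition split_points (k : nat) : {set {set 'I_n} * 'I_n} :=
  [set x : {set 'I_n} * 'I_n |
    [&& #|x.1| == k, clique x.1, x.2 \in x.1 & [exists c in x.1, c < x.2]]].

(** The clique is recovered by forgetting the sides, and the cut as the smallest y-vertex. *)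
Lemma split_clique_inj k : {in split_points k &, injective split_clique}.
Proof.
move=> [C q] [C' q']; rewrite !inE /= => /and4P[_ _ qC _] /and4P[_ _ qC' _] E.
have CC' : C = C'.
  apply/setP=> a; have := X_split_clique C q a; have := Y_split_clique C q a.
  rewrite E X_split_clique Y_split_clique.
  by case: (a \in C); case: (a \in C') => //=; case: ltnP.
have /andP[_ q'q] : (q \in C') && (q' <= q) by rewrite -Y_split_clique -E Y_split_clique qC /=.
have /andP[_ qq'] : (q' \in C) && (q <= q') by rewrite -Y_split_clique E Y_split_clique qC' /=.
by congr (_, _) => //; apply/val_inj/eqP; rewrite eqn_leq qq' q'q.
Qed.

Lemma split_clique_bicomplete k x : x \in split_points k -> bicomplete e k (split_clique x).
Proof.
case: x => C q; rewrite inE /= => /and4P[/eqP Ck Ccl qC /exists_inP[c cC cq]].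
apply/and4P; split.
- by rewrite card_imset ?Ck //; apply: split_vertex_inj.
- by apply/existsP; exists c; rewrite X_split_clique cC.
- by apply/existsP; exists q; rewrite Y_split_clique qC /=.
apply/forallP=> a; apply/forallP=> b; apply/implyP.
rewrite X_split_clique Y_split_clique => /andP[/andP[aC aq] /andP[bC qb]].
have ab := leq_trans aq qb; rewrite ab.
move/forall_inP/(_ a aC)/forall_inP/(_ b bC)/implyP: Ccl; apply.
by apply: contraTneq ab => ->; rewrite ltnn.
Qed.

(** The cut is the smallest y-vertex [q]. Two x-vertices are adjacent because both are joined to the
    larger [q], and two y-vertices because both are joined to a smaller x-vertex [p]. *)
Lemma bicomplete_split k W : bicomplete e k W ->
  exists2 x, x \in split_points k & W = split_clique x.
Proof.
move=> /and4P[/eqP Wk /existsP[p pW] /existsP[q0 q0W] /forallP WP].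
have WXY a b : X_ a \in W -> Y_ b \in W -> (a < b) && e a b.
  by move=> aW bW; have /forallP/(_ b)/implyP := WP a; apply; rewrite aW.
pose C := [set c | (X_ c \in W) || (Y_ c \in W)].
case: (@arg_minnP _ q0 (fun b => Y_ b \in W) (@nat_of_ord n) q0W) => q qW qmin.
have WE : W = split_clique (C, q).
  apply/setP=> v; rewrite -[v]splitK; case: (split v) => a /=.
    rewrite -/(X_ a) X_split_clique inE; apply/idP/andP => [aW|[/orP[//|aY] aq]].
      by have /andP[-> _] := WXY _ _ aW qW; rewrite aW.
    by have := qmin _ aY; rewrite leqNgt aq.
  rewrite -/(Y_ a) Y_split_clique inE; apply/idP/andP => [aW|[/orP[aX|//] qa]].
    by rewrite aW orbT qmin.
  by have /andP[] := WXY _ _ aX qW; rewrite ltnNge qa.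
exists (C, q) => //; rewrite inE /=; apply/and4P; split.
- by rewrite -Wk WE card_imset //; apply: split_vertex_inj.
- have clique_lt a b : a \in C -> b \in C -> a < b -> e a b.
    rewrite !inE => /orP[aW|aW] /orP[bW|bW] ab.
    + have /andP[aq eaq] := WXY _ _ aW qW; have /andP[bq ebq] := WXY _ _ bW qW.
      exact: e_upper ab bq eaq ebq.
    + by have /andP[] := WXY _ _ aW bW.
    + by have /andP[] := WXY _ _ bW aW; rewrite ltnNge ltnW.
    + have /andP[pa epa] := WXY _ _ pW aW; have /andP[pb epb] := WXY _ _ pW bW.
      exact: e_lower pa ab epa epb.
  apply/forall_inP=> a aC; apply/forall_inP=> b bC; apply/implyP=> ab.
  have [ltab|ltba|/val_inj abE] := ltngtP a b; last by rewrite abE eqxx in ab.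
    exact: clique_lt.
  by rewrite e_sym; apply: clique_lt.
- by rewrite inE qW orbT.
- by apply/exists_inP; exists p; rewrite ?inE ?pW //; have /andP[] := WXY _ _ pW qW.
Qed.

(** Each clique allows k-1 cuts, one for each vertex other than its minimum; the empty clique fits
    through [0.-1 = 0]. *)
Lemma card_split_points k : #|split_points k| = k.-1 * nb_cliques e k.
Proof.
pose Q (C : {set 'I_n}) := (#|C| == k) && clique C.
pose R (C : {set 'I_n}) (q : 'I_n) := (q \in C) && [exists c in C, c < q].
have -> : #|split_points k| = \sum_(C | Q C) \sum_(q | R C q) 1.
  rewrite pair_big_dep sum1_card; apply: eq_card => -[C q].
  by rewrite !inE /Q /R /= andbA.
rewrite (eq_bigr (fun=> k.-1)) => [|C /andP[/eqP Ck _]].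
  by rewrite sum_nat_const mulnC; congr (_ * _); apply: eq_card => C; rewrite !inE.
rewrite sum1_card; have [C0|[c0 c0C]] := set_0Vmem C.
  by rewrite -Ck C0 cards0; apply: eq_card0 => q; rewrite unfold_in /R in_set0.
case: (@arg_minnP _ c0 (fun c => c \in C) (@nat_of_ord n) c0C) => m mC mmin.
rewrite -Ck (cardsD1 m C) mC /=; apply: eq_card => q.
rewrite !inE [LHS]unfold_in; have [->|qm] /= := eqVneq q m.
  by apply/negbTE; rewrite negb_and negb_exists_in; apply/orP; right;
     apply/forall_inP=> c cC; rewrite -leqNgt; apply: mmin.
case qC: (q \in C) => //=; apply/exists_inP; exists m => //.
by rewrite ltn_neqAle eq_sym; apply/andP; split; [exact: qm|exact: mmin].
Qed.

Lemma card_bicomplete k : #|{: {W : {set V} | bicomplete e k W}}| = k.-1 * nb_cliques e k.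
Proof.
rewrite -card_split_points card_sig -(card_in_imset (@split_clique_inj k)).
apply: eq_card => W; rewrite inE /=; apply/idP/imsetP => [/bicomplete_split[x]|[x xQ ->]].
  by exists x.
exact: split_clique_bicomplete.
Qed.

End Counting.

(** Existence of a resolution makes the [epsilon] value a genuine rank, so bounds valid for every
    minimal resolution apply to it. *)
Lemma graded_betti_attained (m : nat) (K : fieldType) (I : {mpoly K[m]} -> Prop) i j :
  homogeneous_ideal I -> exists F : min_graded_resolution I,
    resolution_betti F i j = graded_betti I i j.
Proof.
move=> /graded_resolution_exists[F].
apply: (epsilon_spec (inhabits 0%N)
  (fun b => exists F : min_graded_resolution I, resolution_betti F i j = b)).
by exists (resolution_betti F i j), F.
Qed.

(** * Linear Betti numbers bounded by bicomplete subgraphs *)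

Section LinearBetti.
Context {n : nat} {K : fieldType} {e : rel 'I_n} (i : nat).
Local Notation V := 'I_(n + n).
Local Notation bicliques := {W : {set V} | bicomplete e i.+2 W}.

Lemma arrangements_exist : exists place : bicliques -> 'I_n * 'I_n * seq V,
  forall W, arrangement (val W) (place W).1.1 (place W).1.2 (place W).2.
Proof.
suff /fin_all_exists : forall W : bicliques, exists x : 'I_n * 'I_n * seq V,
  arrangement (val W) x.1.1 x.1.2 x.2 by [].
by move=> [W Wb]; have [p [q [s Ws]]] := arrangement_exists Wb; exists (p, q, s).
Qed.

(** One arrangement per bicomplete set gives coordinates that separate cycles. The bound serves both
    J and the edge ideal. *)
Lemma betti_le_bicliques (P : {mpoly K[n + n]} -> Prop) :
  (forall g, P g -> g \is 2.-homog) -> led_by_edges e (ideal_gen P) ->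
  (graded_betti (ideal_gen P) i i.+2 <= #|{: bicliques}|)%N.
Proof.
move=> P_quad P_led.
have [F <-] := graded_betti_attained i i.+2 (quadric_ideal_homogeneous P_quad).
have [place placeP] := arrangements_exist.
pose coord W := ((place W).2, XY (place W).1.1 (place W).1.2).
have low f u : ideal_gen P f -> (mdeg u < 2)%N -> f@_u = 0 by apply: quadric_ideal_low.
apply: (betti_le_coordinates F low (place := coord)) => t t_cycle t0 s.
exact: (cycle_eq0_of_coordinates P_led t_cycle placeP).
Qed.

(** The signed cycles of the bicomplete sets are dual to the coordinates given by the
    arrangements. *)
Lemma bicliques_le_betti :
  (#|{: bicliques}| <= graded_betti (edge_ideal K (initial_graph e)) i i.+2)%N.
Proof.
have [F <-] := graded_betti_attained i i.+2 (quadric_ideal_homogeneous (@edge_ideal_quadric n K e)).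
have [place placeP] := arrangements_exist.
pose coord W := ((place W).2, XY (place W).1.1 (place W).1.2).
pose t W := bicomplete_cycle (K := K) e
  (p0 := (place W).1.1) (q0 := (place W).1.2) (s0 := (place W).2).
have low f u : edge_ideal K (initial_graph e) f -> (mdeg u < 2)%N -> f@_u = 0.
  by move=> If u2; apply: (quadric_ideal_low (@edge_ideal_quadric n K e) If).
apply: (coordinates_le_betti F low (place := coord) (t := t)) => [W|W|W W'].
- exact: bicomplete_cycle_linear (valP W) (placeP W).
- exact: arrangement_size (valP W) (placeP W).
rewrite /cycle_coordinate (coef_bicomplete_cycle (valP W) (placeP W)); last first.
  exact: arrangement_size (valP W') (placeP W').
have [<-|WW'] := eqVneq W W'; first exact: bicomplete_sign_self (placeP W).
apply: (bicomplete_sign_other (valP W) (placeP W) (valP W') (placeP W')).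
by rewrite (inj_eq val_inj).
Qed.

End LinearBetti.

Theorem theorem3p13 (K : fieldType) (n : nat) (e : rel 'I_n)
    (e_sym : ssrbool.symmetric e) (e_irr : irreflexive e)
    (e_closed : closed_graph K e) (i : nat) :
  let J := binomial_edge_ideal K e in
  let inJ := initial_ideal J in
  let I_inG := edge_ideal K (initial_graph e) in
  [/\ (graded_betti J i (i + 2) <= graded_betti inJ i (i + 2))%N,
      graded_betti inJ i (i + 2) = graded_betti I_inG i (i + 2)
    & graded_betti I_inG i (i + 2) = ((i + 1) * nb_cliques e (i + 2))%N].
Proof.
rewrite addn2 addn1 => J inJ I_inG.
(* Extensionality turns the pointwise equivalence of ideals into an equality, so the Betti numbers
   coincide at once. *)
have -> : inJ = I_inG.
  by apply: functional_extensionality => f; apply: propositional_extensionality;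
     apply: initial_ideal_closed.
have cardW := card_bicomplete e_sym (closed_upper e_closed) (closed_lower e_closed) i.+2.
have betti_I : graded_betti I_inG i i.+2 = #|{: {W : {set 'I_(n + n)} | bicomplete e i.+2 W}}|.
  apply/eqP; rewrite eqn_leq bicliques_le_betti andbT.
  exact: betti_le_bicliques (@edge_ideal_quadric n K e) edge_ideal_led.
split=> //; last by rewrite betti_I cardW.
rewrite betti_I.
exact: betti_le_bicliques (@binomial_edge_quadric n K e) binomial_edge_ideal_led.
Qed.
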